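(* Let $\psi:[0,1]\to\mathbb{R}$ be a continuous function belonging to $H^1(0,1)$, with $\psi(0)=0$, satisfying the compatibility interpolation condition $\psi(\theta)+\psi(1-\theta)=1$ for all $\theta\in[0,1]$ and the orthogonality condition $\int_0^1(1-x)\,\psi(x)\,dx=0$. Let $0<\alpha<1<\beta$ and let $\mathcal{U}_{\alpha,\beta}$ be the family of uniformly regular meshes of $[0,1]$. For $f\in L^2(0,1)$ let $u$ be the solution of $$-u''=f\ \text{ in } ]0,1[,\qquad u(0)=u(1)=0,$$ and $p=u'$. (i) For each $f\in L^2(0,1)$ and each mesh $\mathcal{T}\in\mathcal{U}_{\alpha,\beta}$, the solution $(u_{\mathcal T},p_{\mathcal T})\in U_{\mathcal T}\times P_{\mathcal T}$ of the finite volume method is given by solving the mixed Petrov-Galerkin problem $$\gamma\big((u_{\mathcal T},p_{\mathcal T}),(v,q)\big)=-(f,v)\qquad\forall\,(v,q)\in U_{\mathcal T}\times Q^{\psi}_{\mathcal T}.$$ (ii) Moreover, there exists a constant $C>0$ depending only on $\alpha$ and $\beta$ such that, for every $f\in H^1(0,1)$ and every $\mathcal{T}\in\mathcal{U}_{\alpha,\beta}$, $$\|u-u_{\mathcal T}\|_0+\|p-p_{\mathcal T}\|_1\le C\,h_{\mathcal T}\,\|f\|_1 .$$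
   Context: Norms: $(\cdot,\cdot)$ and $\|\cdot\|_0$ are the scalar product and norm of $L^2(0,1)$, and $\|q\|_1=(\|q\|_0^2+\|q'\|_0^2)^{1/2}$ is the norm of $H^1(0,1)$. In one dimension $\mathrm{div}\,q=q'$. Meshes: a mesh $\mathcal T$ with $n=n_{\mathcal T}\ge1$ elements is a set of vertices $0=x_0<x_1<\dots<x_n=1$; its elements are $]x_j,x_{j+1}[$, with lengths $h_{j+1/2}=x_{j+1}-x_j$ ($0\le j\le n-1$), and $h_{\mathcal T}=\max_j h_{j+1/2}$. For $0<\alpha<1<\beta$, $\mathcal U_{\alpha,\beta}$ is the class of all meshes such that $\alpha/n_{\mathcal T}\le h_{j+1/2}\le\beta/n_{\mathcal T}$ for all $j=0,\dots,n_{\mathcal T}-1$. Discrete spaces: $U_{\mathcal T}$ is the space of functions that are constant on each element. $P_{\mathcal T}$ is the space of continuous functions on $[0,1]$ that are affine on each element; its basis $(\varphi_j)_{0\le j\le n}$ is defined by $\varphi_j(x_k)=\delta_{jk}$. $Q^\psi_{\mathcal T}$ is the linear span of the functions $\psi_0,\dots,\psi_n$ on $[0,1]$ defined by $\psi_j(x)=\psi\big(\frac{x-x_{j-1}}{h_{j-1/2}}\big)$ if $x_{j-1}\le x\le x_j$, $\psi_j(x)=\psi\big(\frac{x_{j+1}-x}{h_{j+1/2}}\big)$ if $x_j\le x\le x_{j+1}$, and $\psi_j(x)=0$ elsewhere (for $j=0$ and $j=n$ only the piece lying in $[0,1]$ is used). Bilinear form: $\gamma((u,p),(v,q))=(p,q)+(u,\mathrm{div}\,q)+(\mathrm{div}\,p,v)$.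 Finite volume method: set $h_0=\tfrac12h_{1/2}$, $h_n=\tfrac12h_{n-1/2}$ and $h_j=\tfrac12(h_{j-1/2}+h_{j+1/2})$ for $1\le j\le n-1$. The unknowns $u_{j+1/2}$ ($0\le j\le n-1$) and $p_j$ ($0\le j\le n$) satisfy $$p_j=\frac1{h_j}(u_{j+1/2}-u_{j-1/2}),\ 0\le j\le n,\qquad u_{-1/2}=u_{n+1/2}=0,$$ $$\frac1{h_{j+1/2}}(p_{j+1}-p_j)+\frac1{h_{j+1/2}}\int_{x_j}^{x_{j+1}}f(x)\,dx=0,\quad 0\le j\le n-1.$$ The associated functions are $u_{\mathcal T}\in U_{\mathcal T}$, equal to $u_{j+1/2}$ on $]x_j,x_{j+1}[$, and $p_{\mathcal T}=\sum_{j=0}^n p_j\varphi_j\in P_{\mathcal T}$. *)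

(* Defs.v *)
From HB Require Import structures.
From mathcomp Require Import all_boot all_order all_algebra.
From mathcomp Require Import all_classical all_reals all_analysis.
From mathcomp Require Import ring.

Set Implicit Arguments.
Unset Strict Implicit.
Unset Printing Implicit Defensive.
Import Order.TTheory GRing.Theory Num.Theory.
Import numFieldNormedType.Exports.
Local Open Scope classical_set_scope.
Local Open Scope ring_scope.

Section Sobolev.
Context {R : realType}.
Implicit Types f g q u phi : R -> R.
Local Notation mu := (@lebesgue_measure R).

(* Functions on [0, 1] are represented by functions R -> R; every notion below
   only looks at their values on [0, 1] (and most of them only on ]0, 1[). *)

Definition L2 f : Prop := (f \_ `]0, 1[) \in Lfun mu 2%:E.

Definition dotL2 f g : R := \int[mu]_(x in `]0, 1[) (f x * g x).

Definition normL2 f : \bar R := 'N[mu]_(2%:E)[EFin \o (f \_ `]0%R, 1%R[)]%E.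

(* The class C^1_c(]0, 1[); see H. Brezis, Functional Analysis, Sobolev Spaces
   and Partial Differential Equations, section 8.2, for the definition of
   H^1(0, 1) with C^1_c (instead of C^oo_c) test functions. *)
Definition test_function phi : Prop :=
  [/\ forall x, derivable phi x 1,
      continuous (derive1 phi) &
      closure [set x | phi x != 0] `<=` `]0, 1[ ].

Definition is_weak_deriv q g : Prop :=
  forall phi, test_function phi ->
    dotL2 q (derive1 phi) = - dotL2 g phi.

Definition H1 q : Prop :=
  L2 q /\ exists g, L2 g /\ is_weak_deriv q g.

(* A representative of the weak derivative (unique up to a negligible set) of
   an element of H^1(0, 1); the zero function outside H^1(0, 1). *)
Definition wderiv q : R -> R :=
  xget (cst 0) [set g | L2 g /\ is_weak_deriv q g].

Definition normH1 q : \bar R :=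
  if `[< H1 q >] then sqrte (normL2 q ^+ 2 + normL2 (wderiv q) ^+ 2)%E
  else +oo%E.

(* -u'' = f in ]0, 1[ and u(0) = u(1) = 0: u is the continuous representative
   of an element of H^1(0, 1), so that its boundary values make sense, and the
   equation holds in the sense of distributions. *)
Definition poisson_solution f u : Prop :=
  [/\ H1 u, {within `[0, 1], continuous u}, u 0 = 0, u 1 = 0 &
      is_weak_deriv (wderiv u) (\- f)].

Definition gammaform (up vq : (R -> R) * (R -> R)) : R :=
  dotL2 up.2 vq.2 + dotL2 up.1 (wderiv vq.2) + dotL2 (wderiv up.2) vq.1.

End Sobolev.

(* Only the values vtx 0, ..., vtx ncell are relevant. *)
Record mesh (R : realType) := Mesh {
  ncell : nat ;
  vtx : nat -> R ;
  ncell_gt0 : (0 < ncell)%N ;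
  vtx0 : vtx 0%N = 0 ;
  vtxn : vtx ncell = 1 ;
  vtx_lt : forall j, (j < ncell)%N -> vtx j < vtx j.+1 }.

Section Discrete.
Context {R : realType}.
Implicit Types (M : mesh R) (f v q psi : R -> R) (j : nat).
Local Notation mu := (@lebesgue_measure R).

(* hcell M j is h_{j+1/2}. *)
Definition hcell M j : R := vtx M j.+1 - vtx M j.

Definition hmax M : R := \big[Num.max/0]_(j < ncell M) hcell M j.

Definition uniformly_regular (alpha beta : R) M : Prop :=
  forall j, (j < ncell M)%N ->
    alpha / (ncell M)%:R <= hcell M j <= beta / (ncell M)%:R.

Definition UT M v : Prop :=
  forall j, (j < ncell M)%N ->
    exists c, forall x, x \in `]vtx M j, vtx M j.+1[ -> v x = c.

Definition PT M q : Prop :=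
  {within `[0, 1], continuous q} /\
  forall j, (j < ncell M)%N ->
    exists a b, forall x, x \in `]vtx M j, vtx M j.+1[ -> q x = a * x + b.

Definition shape psi M j : R -> R := fun x =>
  if (0 < j)%N && (vtx M j.-1 <= x <= vtx M j) then
    psi ((x - vtx M j.-1) / hcell M j.-1)
  else if (j < ncell M)%N && (vtx M j <= x <= vtx M j.+1) then
    psi ((vtx M j.+1 - x) / hcell M j)
  else 0.

Definition QT psi M q : Prop :=
  exists c : nat -> R,
    forall x, x \in `[0, 1] -> q x = \sum_(j < (ncell M).+1) c j * shape psi M j x.

(* The nodal basis of P_T; see hatP. *)
Definition hat M j : R -> R := shape id M j.

(* The compatibility interpolation and orthogonality conditions. *)
Definition admissible_shape psi : Prop :=
  [/\ {within `[0, 1], continuous psi}, H1 psi, psi 0 = 0,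
      forall t, t \in `[0, 1] -> psi t + psi (1 - t) = 1 &
      \int[mu]_(x in `[0, 1]) ((1 - x) * psi x) = 0].

(* hdual M j is h_j. *)
Definition hdual M j : R :=
  if j == 0%N then 2^-1 * hcell M 0
  else if j == ncell M then 2^-1 * hcell M (ncell M).-1
  else 2^-1 * (hcell M j.-1 + hcell M j).

(* The unknowns are indexed with a shift: uh j is u_{j-1/2}, for j between 0
   and n + 1, and ph j is p_j, for j between 0 and n. *)
Definition fv_scheme M f (uh ph : nat -> R) : Prop :=
  [/\ uh 0%N = 0, uh (ncell M).+1 = 0,
      forall j, (j <= ncell M)%N ->
        ph j = (hdual M j)^-1 * (uh j.+1 - uh j) &
      forall j, (j < ncell M)%N ->
        (hcell M j)^-1 * (ph j.+1 - ph j) +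
        (hcell M j)^-1 * \int[mu]_(x in `[vtx M j, vtx M j.+1]) f x = 0].

Definition fv_solution M f (uT pT : R -> R) : Prop :=
  exists uh ph : nat -> R,
    [/\ fv_scheme M f uh ph,
        forall j, (j < ncell M)%N ->
          forall x, x \in `]vtx M j, vtx M j.+1[ -> uT x = uh j.+1 &
        forall x, x \in `[0, 1] ->
          pT x = \sum_(j < (ncell M).+1) ph j * hat M j x].

Definition pg_solution psi M f (uT pT : R -> R) : Prop :=
  [/\ UT M uT, PT M pT &
      forall v q, UT M v -> QT psi M q ->
        gammaform (uT, pT) (v, q) = - dotL2 f v].

Lemma vtx_mono M i j : (i <= j <= ncell M)%N -> vtx M i <= vtx M j.
Proof.
case/andP; elim: j => [|j IHj]; first by rewrite leqn0 => /eqP ->.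
rewrite leq_eqVlt ltnS => /predU1P[-> //|ij jn].
by rewrite (le_trans (IHj ij (ltnW jn)))// ltW// vtx_lt.
Qed.

Lemma vtx_smono M i j : (i < j <= ncell M)%N -> vtx M i < vtx M j.
Proof.
case/andP=> ij jn; rewrite (@lt_le_trans _ _ (vtx M i.+1))//.
  by rewrite vtx_lt// (leq_trans ij).
by rewrite vtx_mono// ij.
Qed.

Lemma PT_affine M q :
  (forall k, (k < ncell M)%N ->
    exists a b, forall x, vtx M k <= x <= vtx M k.+1 -> q x = a * x + b) ->
  PT M q.
Proof.
move=> qaff; split; last first.
  move=> k /qaff[a [b ab]]; exists a, b => x; rewrite in_itv/= => /andP[? ?].
  by rewrite ab// !ltW.
suff H k : (k <= ncell M)%N -> {within `[vtx M 0, vtx M k], continuous q}.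
  by have := H _ (leqnn _); rewrite vtx0 vtxn.
elim: k => [_|k IHk kn]; first by rewrite set_itv1; exact: continuous_subspace1.
have -> : `[vtx M 0, vtx M k.+1]%classic =
    `[vtx M 0, vtx M k] `|` `[vtx M k, vtx M k.+1].
  have h0 : vtx M 0 <= vtx M k by rewrite vtx_mono// (ltnW kn).
  have hk : vtx M k <= vtx M k.+1 by rewrite ltW ?vtx_lt.
  apply/seteqP; split => x /=; rewrite !in_itv/=.
    case/andP=> -> ->; rewrite andbT /=.
    by case: (leP x (vtx M k)) => [_|/ltW ->]; [left|right].
  case=> /andP[kx xk]; first by rewrite kx (le_trans xk hk).
  by rewrite xk (le_trans h0 kx).
apply: withinU_continuous; [exact: itv_closed|exact: itv_closed|exact/IHk/ltnW|].
have [a [b ab]] := qaff k kn.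
apply: (@subspace_eq_continuous _ _ _ (fun x => a * x + b)).
  by move=> x; rewrite inE/= in_itv/= => /ab.
apply: continuous_subspaceT => x.
apply: cvgD; last exact: cvg_cst.
by apply: cvgM; [exact: cvg_cst|exact: cvg_id].
Qed.

Lemma hcell_gt0 M j : (j < ncell M)%N -> 0 < hcell M j.
Proof. by move=> jn; rewrite subr_gt0 vtx_lt. Qed.

Lemma hatP M j : (j <= ncell M)%N ->
  PT M (hat M j) /\
  forall k, (k <= ncell M)%N -> hat M j (vtx M k) = (j == k)%:R.
Proof.
move=> jn; split.
- apply: PT_affine => k kn; have hk := hcell_gt0 kn.
  have [jk|jk|jk] := ssrnat.ltngtP j k.
  + exists 0, 0 => x /andP[kx xk]; rewrite mul0r addr0 /hat /shape.
    have j1k : vtx M j.+1 <= vtx M k by rewrite vtx_mono// jk ltnW.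
    have jj1 : vtx M j < vtx M j.+1 by rewrite vtx_lt// (leq_ltn_trans _ kn)// ltnW.
    rewrite (lt_geF (lt_le_trans jj1 (le_trans j1k kx)))/= !andbF.
    case: ifPn => // /andP[_ /andP[_ xj]].
    have -> : x = vtx M j.+1.
      by apply/eqP; rewrite eq_le xj (le_trans j1k).
    by rewrite subrr mul0r.
  + move: jk; rewrite leq_eqVlt => /predU1P[<-|jk].
      exists (hcell M k)^-1, (- vtx M k / hcell M k) => x kx.
      by rewrite /hat /shape /= kx/= mulrDl mulrC.
    exists 0, 0 => x /andP[kx xk]; rewrite mul0r addr0 /hat /shape.
    case: j jn jk => // j jn; rewrite ltnS /= => jk.
    have k1j : vtx M k.+1 <= vtx M j by rewrite vtx_mono// jk ltnW.
    have jj1 : vtx M j < vtx M j.+1 by rewrite vtx_lt.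
    rewrite (lt_geF (le_lt_trans (le_trans xk k1j) jj1))/= andbF.
    case: ifPn => // /andP[jx _].
    have -> : x = vtx M j by apply/eqP; rewrite eq_le jx (le_trans xk).
    by rewrite subrr mul0r.
  + subst k; exists (- (hcell M j)^-1), (vtx M j.+1 / hcell M j) => x /andP[kx xk].
    rewrite /hat /shape kn kx xk /=.
    case: ifPn => [/andP[j0 /andP[_ xj]]|_]; last by rewrite mulrBl; ring.
    have -> : x = vtx M j by apply/eqP; rewrite eq_le kx xj.
    case: j jn kn hk kx xk xj j0 => // j jn jn1 hk _ _ _ _ /=.
    have -> : - (hcell M j.+1)^-1 * vtx M j.+1 + vtx M j.+2 / hcell M j.+1 =
        hcell M j.+1 / hcell M j.+1 by rewrite [in RHS]/hcell; ring.
    by rewrite !divff ?gt_eqF ?hcell_gt0.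
- move=> k kn; rewrite /hat /shape.
  have [jk|jk|jk] := ssrnat.ltngtP j k.
  + have jk' : vtx M j < vtx M k by rewrite vtx_smono// jk.
    have jk1 : vtx M j.+1 <= vtx M k by rewrite vtx_mono// jk.
    rewrite (lt_geF jk')/= !andbF.
    case: ifPn => // /andP[_ /andP[_ kj]].
    have -> : vtx M k = vtx M j.+1 by apply/eqP; rewrite eq_le kj.
    by rewrite subrr mul0r.
  + case: j jn jk => // j jn; rewrite ltnS => kj /=.
    have kj' : vtx M k < vtx M j.+1 by rewrite vtx_smono// ltnS kj.
    have kj1 : vtx M k <= vtx M j by rewrite vtx_mono// kj ltnW.
    rewrite (lt_geF kj')/= andbF.
    case: ifPn => // /andP[jk _].
    have -> : vtx M k = vtx M j by apply/eqP; rewrite eq_le jk kj1.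
    by rewrite subrr mul0r.
  + subst k; case: j jn kn => [_ _|j jn _] /=.
      rewrite ncell_gt0 lexx ltW ?vtx_lt ?ncell_gt0//= divff//.
      by rewrite gt_eqF ?hcell_gt0 ?ncell_gt0.
    by rewrite lexx ltW ?vtx_lt//= divff// gt_eqF// hcell_gt0.
Qed.

End Discrete.

(* Main.v *)
Require Import Defs.
From mathcomp Require Import all_boot all_order all_algebra.
From mathcomp Require Import all_classical all_reals all_analysis.
From mathcomp Require Import measurable_realfun ring lra.

(** The two methods coincide because the Petrov-Galerkin equations, written
    for a basis of test functions, are the finite volume equations. Since u_T
    and v are constant on cells, the terms (u_T, q') and (p_T', v) only
    involve the increments of q and p_T over the cells
    ([itvint_step_primitive]). The term (p_T, q) is a sum of integrals over
    the cells which, once rescaled to [0, 1], depend on psi only through the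
    integrals of psi and s psi. The two conditions on psi make both equal to
    1/2, so that the mass matrix is diagonal, its entries being the dual
    lengths h_j ([itvint_reference], [hdual_sum]). Let c_j be the nodal values
    of q and v_k the values of v on the cells. By a summation by parts, and
    since u_{-1/2} = u_{n+1/2} = 0, [gammaform_sum] reads

      gamma = sum_j (h_j p_j - (u_{j+1/2} - u_{j-1/2})) c_j
              + sum_k v_k (p_{k+1} - p_k),

    whose coefficients are the residuals of the scheme. The scheme itself is
    solved explicitly: the fluxes are known up to a constant, fixed by the
    vanishing of sum_j h_j p_j ([fv_exists], [fv_explicit]).

    For the error estimate, p_T' is the opposite of the average of f over the
    cell, so that p' - p_T' is the opposite of the oscillation of f on the
    cell, which is controlled by f' ([cell_oscillation], [average_errorL2]).
    Moreover p and p_T have the same increments over cells: p - p_T is the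
    interpolation error d of p plus a constant e. Since p has mean zero, as u
    vanishes at 0 and 1, and the trapezoidal sum of p_T vanishes, as its
    discrete counterpart does, e is the opposite of the integral of d, and
    p - p_T is of order h ([flux_error]). Finally the discrete u is, up to half a cell, the integral
    of p_T ([value_trapezoid]), whence the bound on u - u_T ([value_error]).

    The analysis behind this is the theory of H^1(0, 1): a continuous function
    on [0, 1] is in H^1(0, 1), with weak derivative g, exactly when it is a primitive of
    the square-integrable function g. One direction is an integration by parts
    ([primitive_ibp]); it shows in particular that the test fluxes are in
    H^1(0, 1). The other one is the lemma of du Bois-Reymond
    ([weak_deriv0_continuous], [weak_deriv0_ae]): testing against differences
    of plateau functions shows that a function with vanishing weak derivative
    has the same integral over all intervals of the same length. It also gives the
    uniqueness of weak derivatives, needed since the norm of H^1 is computed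
    with a chosen representative. *)

Set Implicit Arguments.
Unset Strict Implicit.
Unset Printing Implicit Defensive.
Import Order.TTheory GRing.Theory Num.Theory.
Import numFieldNormedType.Exports.
Local Open Scope classical_set_scope.
Local Open Scope ring_scope.

(** * Integrals over open intervals *)

Section IntervalIntegrals.
Context {R : realType}.
Implicit Types (a b c x y k : R) (f g : R -> R).
Local Notation mu := (@lebesgue_measure R).

(** Over open intervals, because the elements of U_T and their products are
    prescribed only inside the cells. *)
Definition L1on a b f : Prop := mu.-integrable `]a, b[ (EFin \o f).

Definition L2on a b f : Prop :=
  measurable_fun `]a, b[ f /\ L1on a b (fun x => f x ^+ 2).

Definition itvint a b f : R := \int[mu]_(x in `]a, b[) f x.

Lemma L1on_measurable a b f : L1on a b f -> measurable_fun `]a, b[ f.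
Proof. by case/integrableP => /measurable_EFinP. Qed.

Lemma eq_L1on a b f g : (forall x, a < x < b -> f x = g x) ->
  L1on a b f -> L1on a b g.
Proof.
move=> fg; apply: eq_integrable => // x; rewrite inE/= in_itv/= => /fg.
by move=> ->.
Qed.

Lemma eq_itvint a b f g : (forall x, a < x < b -> f x = g x) ->
  itvint a b f = itvint a b g.
Proof.
by move=> fg; apply: eq_Rintegral => x; rewrite inE/= in_itv/= => /fg.
Qed.

Lemma eq_measurable_itv a b f g : (forall x, a < x < b -> f x = g x) ->
  measurable_fun `]a, b[ f -> measurable_fun `]a, b[ g.
Proof.
by move=> fg; apply: eq_measurable_fun => x; rewrite inE/= in_itv/= => /fg.
Qed.

Lemma eq_L2on a b f g : (forall x, a < x < b -> f x = g x) ->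
  L2on a b f -> L2on a b g.
Proof.
move=> fg [mf f2]; split; first exact: eq_measurable_itv mf.
by apply: eq_L1on f2 => x /fg ->.
Qed.

Lemma L1on_le a b f g : measurable_fun `]a, b[ f ->
  (forall x, a < x < b -> `|f x| <= g x) -> L1on a b g -> L1on a b f.
Proof.
move=> mf fg; apply: le_integrable => //; first exact/measurable_EFinP.
move=> x /=; rewrite in_itv/= => /fg h.
by rewrite lee_fin (le_trans h)// ler_norm.
Qed.

Lemma L1on_cst a b k : L1on a b (fun=> k).
Proof.
have ab_fin : (mu `]a, b[ < +oo)%E.
  by rewrite lebesgue_measure_itv/=; case: ifPn => // _; rewrite -EFinD ltry.
apply: (measurable_bounded_integrable _ ab_fin) => //.
by exists `|k|; split => [|M /ltW kM x _ /=]; rewrite ?num_real.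
Qed.

Lemma L1onD a b f g : L1on a b f -> L1on a b g -> L1on a b (fun x => f x + g x).
Proof. by move=> f1 g1; apply: (integrableD _ f1 g1). Qed.

Lemma L1onB a b f g : L1on a b f -> L1on a b g -> L1on a b (fun x => f x - g x).
Proof. by move=> f1 g1; apply: (integrableB _ f1 g1). Qed.

Lemma L1onZ a b k f : L1on a b f -> L1on a b (fun x => k * f x).
Proof. by move=> f1; apply: (integrableZl _ k f1). Qed.

Lemma L1on_norm a b f : L1on a b f -> L1on a b (fun x => `|f x|).
Proof. by move=> f1; apply: (integrable_norm f1). Qed.

Lemma L1on_sub a b c d f : a <= c -> d <= b -> L1on a b f -> L1on c d f.
Proof.
move=> ac db; apply: integrableS => //.
by apply: subset_itv; rewrite bnd_simp.
Qed.

Lemma L1onM_bounded a b f g K : L1on a b f -> measurable_fun `]a, b[ g ->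
  (forall x, a < x < b -> `|g x| <= K) -> L1on a b (fun x => f x * g x).
Proof.
move=> f1 mg gK; have f1K := L1onZ K (L1on_norm f1).
apply: L1on_le f1K; first exact: measurable_funM (L1on_measurable f1) mg.
by move=> x /gK xK; rewrite normrM mulrC ler_wpM2r.
Qed.

Lemma L2on_L1 a b f : L2on a b f -> L1on a b f.
Proof.
case=> mf f2; apply: L1on_le (L1onD (L1on_cst a b 1) f2) => // x _.
rewrite ler_norml; apply/andP; split; nra.
Qed.

Lemma L2onM a b f g : L2on a b f -> L2on a b g -> L1on a b (fun x => f x * g x).
Proof.
move=> [mf f2] [mg g2]; apply: L1on_le (L1onD f2 g2).
  exact: measurable_funM.
by move=> x _; rewrite ler_norml; apply/andP; split; nra.
Qed.

Lemma L2onD a b f g : L2on a b f -> L2on a b g -> L2on a b (fun x => f x + g x).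
Proof.
move=> hf hg; have fg := L2onM hf hg; case: hf hg => [mf f2] [mg g2].
split; first exact: measurable_funD.
apply: eq_L1on (L1onD (L1onD f2 g2) (L1onZ 2 fg)) => x _; ring.
Qed.

Lemma L2onZ a b k f : L2on a b f -> L2on a b (fun x => k * f x).
Proof.
move=> [mf f2]; split; first exact: measurable_funM.
by apply: eq_L1on (L1onZ (k ^+ 2) f2) => x _; ring.
Qed.

Lemma L2onN a b f : L2on a b f -> L2on a b (fun x => - f x).
Proof. by move=> /(L2onZ (-1)); apply: eq_L2on => x _; rewrite mulN1r. Qed.

Lemma L2onB a b f g : L2on a b f -> L2on a b g -> L2on a b (fun x => f x - g x).
Proof. by move=> hf /L2onN; exact: L2onD. Qed.

Lemma L2on_cst a b k : L2on a b (fun=> k).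
Proof. by split => //; exact: L1on_cst. Qed.

Lemma L2on_sub a b c d f : a <= c -> d <= b -> L2on a b f -> L2on c d f.
Proof.
move=> ac db [mf f2]; split; last exact: L1on_sub f2.
apply: measurable_funS mf => //.
by apply: subset_itv; rewrite bnd_simp.
Qed.

Lemma L2on_bounded a b f K : measurable_fun `]a, b[ f ->
  (forall x, a < x < b -> `|f x| <= K) -> L2on a b f.
Proof.
move=> mf fK; split => //.
apply: L1on_le (L1on_cst a b (K ^+ 2)).
  exact: measurable_funX.
move=> x /fK xK; rewrite normrX ler_sqr ?nnegrE//.
exact: le_trans xK.
Qed.

Lemma itvintD a b f g : L1on a b f -> L1on a b g ->
  itvint a b (fun x => f x + g x) = itvint a b f + itvint a b g.
Proof. by move=> f1 g1; apply: RintegralD. Qed.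

Lemma itvintB a b f g : L1on a b f -> L1on a b g ->
  itvint a b (fun x => f x - g x) = itvint a b f - itvint a b g.
Proof. by move=> f1 g1; apply: RintegralB. Qed.

Lemma itvintZ a b k f : L1on a b f ->
  itvint a b (fun x => k * f x) = k * itvint a b f.
Proof. by move=> f1; apply: RintegralZl. Qed.

Lemma itvintN a b f : L1on a b f ->
  itvint a b (fun x => - f x) = - itvint a b f.
Proof.
move=> f1; rewrite -mulN1r -itvintZ//.
by apply: eq_itvint => x _; rewrite mulN1r.
Qed.

Lemma itvint_cst a b k : a <= b -> itvint a b (fun=> k) = k * (b - a).
Proof.
move=> ab; have -> : b - a = fine (mu `]a, b[); last exact: Rintegral_cst.
rewrite lebesgue_measure_itv/= lte_fin.
by move: ab; rewrite le_eqVlt => /predU1P[->|->]; rewrite ?ltxx ?subrr.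
Qed.

Lemma itvintxx a f : itvint a a f = 0.
Proof. by rewrite /itvint set_itv_ge ?Rintegral_set0// bnd_simp ltxx. Qed.

Lemma le_itvint a b f g : L1on a b f -> L1on a b g ->
  (forall x, a < x < b -> f x <= g x) -> itvint a b f <= itvint a b g.
Proof.
by move=> f1 g1 fg; apply: le_Rintegral => // x /=; rewrite in_itv/= => /fg.
Qed.

Lemma itvint_ge0 a b f : (forall x, a < x < b -> 0 <= f x) -> 0 <= itvint a b f.
Proof.
by move=> f0; apply: Rintegral_ge0 => x /=; rewrite in_itv/= => /f0.
Qed.

Lemma normr_itvint a b f : L1on a b f ->
  `|itvint a b f| <= itvint a b (fun x => `|f x|).
Proof. by move=> f1; apply: le_normr_Rintegral. Qed.

Lemma normr_itvint_le a b f K : a <= b -> L1on a b f ->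
  (forall x, a < x < b -> `|f x| <= K) -> `|itvint a b f| <= K * (b - a).
Proof.
move=> ab f1 fK; apply: (le_trans (normr_itvint f1)).
rewrite -itvint_cst//; apply: le_itvint => //; first exact: L1on_norm.
exact: L1on_cst.
Qed.

Lemma L1on_cat a b c f : a <= b -> b <= c -> L1on a b f -> L1on b c f ->
  L1on a c f.
Proof.
move=> ab bc fab fbc; have mfab := L1on_measurable fab.
have mfbc := L1on_measurable fbc.
have E : `]a, c[%classic `<=` `]a, b[ `|` ([set b] `|` `]b, c[).
  move=> x /=; rewrite !in_itv/= => /andP[ax xc].
  by case: (ltgtP x b) => [xb|bx|->]; [left|right; right|right; left];
    rewrite ?ax.
have mE : measurable (`]a, b[ `|` ([set b] `|` `]b, c[%classic)).
  by do 2 apply: measurableU => //.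
apply: (@integrableS _ _ _ mu _ _ (EFin \o f) mE _ E) => //.
have m1 : measurable_fun ([set b] `|` `]b, c[%classic) f.
  by apply/measurable_funU => //; split => //; exact: measurable_fun_set1.
apply/integrableP; split.
  apply/measurable_EFinP/measurable_funU => //; exact: measurableU.
apply: (@le_lt_trans _ _ (\int[mu]_(x in `]a, b[) `|(f x)%:E| +
   (\int[mu]_(x in [set b]) `|(f x)%:E| + \int[mu]_(x in `]b,
     c[) `|(f x)%:E|))%E).
  rewrite ge0_integral_setU//=.
  - rewrite leeD2l// ge0_integral_setU//=.
    + by apply/measurable_EFinP/measurableT_comp.
    + by apply/disj_setPS => x [/= ->]; rewrite in_itv/= ltxx.
  - exact: measurableU.
  - apply/measurable_EFinP/measurableT_comp => //.
    by apply/measurable_funU => //; exact: measurableU.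
  - apply/disj_setPS => x [/=]; rewrite !in_itv/= => /andP[ax xb] [xe|/andP[bx
    _]].
      by rewrite xe ltxx in xb.
    by have := lt_trans xb bx; rewrite ltxx.
rewrite lte_add_pinfty//; first by case/integrableP: fab.
rewrite integral_set1 add0e.
by case/integrableP: fbc.
Qed.

Lemma itvint_cat a b c f : a <= b -> b <= c -> L1on a c f ->
  itvint a c f = itvint a b f + itvint b c f.
Proof.
move=> ab bc fac.
have fab : L1on a b f by exact: L1on_sub fac.
have fbc : L1on b c f by exact: L1on_sub fac.
move: ab; rewrite le_eqVlt => /predU1P[->|ab]; first by rewrite itvintxx add0r.
move: bc; rewrite le_eqVlt => /predU1P[<-|bc]; first by rewrite itvintxx addr0.
rewrite /itvint (@itv_bndbnd_setU _ _ _ (BRight b)) ?bnd_simp//;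
  last exact: ltW.
rewrite Rintegral_setU//.
- by rewrite Rintegral_itv_bndo_bndc.
- by rewrite -itv_bndbnd_setU ?bnd_simp//; exact: ltW.
- apply/disj_setPS => x [/=]; rewrite !in_itv/= => /andP[ax xb] /andP[bx _].
  by have := le_lt_trans xb bx; rewrite ltxx.
Qed.

(** The finite volume scheme integrates over closed cells. *)
Lemma itvint_cc a b f : measurable_fun `]a, b[ f ->
  \int[mu]_(x in `[a, b]) f x = itvint a b f.
Proof.
move=> mf; rewrite /itvint /Rintegral.
have [ab|ba] := ltP a b; last first.
  rewrite [in RHS]set_itv_ge ?bnd_simp -?leNgt// integral_set0.
  move: ba; rewrite le_eqVlt => /predU1P[->|ba];
    first by rewrite set_itv1 integral_set1.
  by rewrite set_itv_ge ?bnd_simp -?ltNge// integral_set0.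
have mf' : measurable_fun `]a, b] f by exact/measurable_fun_itv_bndo_bndcP.
rewrite -integral_itv_obnd_cbnd; last exact/measurable_EFinP.
by rewrite -integral_itv_bndo_bndc//; exact/measurable_EFinP.
Qed.

(** Cauchy-Schwarz against the constant function 1, obtained from the
    nonnegativity of the variance of f. *)
Lemma itvint_sqr_le a b f : a <= b -> L2on a b f ->
  itvint a b f ^+ 2 <= (b - a) * itvint a b (fun x => f x ^+ 2).
Proof.
rewrite le_eqVlt => /predU1P[<-|ab] hf.
  by rewrite !itvintxx expr0n/= mulr0.
have f1 := L2on_L1 hf; case: (hf) => _ f2.
set I := itvint a b f; set h := b - a; have h0 : 0 < h by rewrite subr_gt0.
pose m := I / h.
have : 0 <= itvint a b (fun x => (f x - m) ^+ 2).
  by apply: itvint_ge0 => x _; exact: sqr_ge0.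
have -> : itvint a b (fun x => (f x - m) ^+ 2) =
    itvint a b (fun x => f x ^+ 2) - I ^+ 2 / h.
  rewrite (@eq_itvint _ _ _ (fun x => (f x ^+ 2 + (- 2 * m) * f x) + m ^+ 2));
    last first.
    by move=> x _; ring.
  have i1 : L1on a b (fun x => - 2 * m * f x) by exact: L1onZ.
  rewrite itvintD; [|exact: L1onD|exact: L1on_cst].
  rewrite itvintD// itvintZ// itvint_cst ?(ltW ab)// -/I -/h /m.
  field; exact: lt0r_neq0.
by rewrite subr_ge0 ler_pdivrMr// mulrC.
Qed.

Lemma L1on_continuous a b f : {within `[a, b], continuous f} -> L1on a b f.
Proof.
move=> cf; rewrite /L1on; apply: (@integrableS _ _ _ mu `[a, b]%classic) => //.
  by apply: subset_itv; rewrite bnd_simp.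
by apply: continuous_compact_integrable => //; exact: segment_compact.
Qed.

Lemma continuous_bounded a b f : {within `[a, b], continuous f} ->
  exists2 K, 0 < K & forall x, a <= x <= b -> `|f x| <= K.
Proof.
move=> cf.
have : bounded_set (f @` `[a, b]).
  exact/compact_bounded/(continuous_compact cf)/segment_compact.
case=> M [Mr MB]; exists (`|M| + 1); first by rewrite ltr_wpDl.
move=> x xab; apply: (MB (`|M| + 1)).
  by rewrite (le_lt_trans (ler_norm _))// ltrDl.
by exists x => //=; rewrite in_itv.
Qed.

Lemma continuous_measurable_itv a b f : {within `[a, b], continuous f} ->
  measurable_fun `]a, b[ f.
Proof. by move/L1on_continuous/L1on_measurable. Qed.

Lemma L2on_continuous a b f : {within `[a, b], continuous f} -> L2on a b f.
Proof.
move=> cf; have [K _ fK] := continuous_bounded cf.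
apply: (@L2on_bounded _ _ _ K); first exact: continuous_measurable_itv.
by move=> x /andP[/ltW ax /ltW xb]; apply: fK; rewrite ax.
Qed.

End IntervalIntegrals.

(** * Affine changes of variable *)

Section AffineChange.
Context {R : realType}.
Implicit Types (a b c d h x y k : R) (f g q : R -> R).
Local Notation mu := (@lebesgue_measure R).

Local Definition affine a h x : R := (x - a) / h.

Let measurable_affine a h :
  @measurable_fun _ _ (measurableTypeR R) (measurableTypeR R) setT (affine a h).
Proof. by apply: measurable_funM => //; apply: measurable_funB. Qed.

Let affine_preimage a h c d (b1 b2 : bool) : 0 < h ->
  affine a h @^-1` [set` Interval (BSide b1 c) (BSide b2 d)] =
  [set` Interval (BSide b1 (a + h * c)) (BSide b2 (a + h * d))].
Proof.
move=> h0; apply/seteqP; split => x /=; rewrite !in_itv/= /affine;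
  case: b1; case: b2; rewrite /= ?ler_pdivlMr// ?ler_pdivrMr// ?ltr_pdivlMr//
    ?ltr_pdivrMr//; move=> /andP[? ?]; apply/andP; split; nra.
Qed.

Let pushforward_measure a h : {measure set (measurableTypeR R) -> \bar R} :=
  measure_function_pushforward__canonical__measure_function_Measure mu
    (measurable_affine a h).

Let absV h : {nonneg R} := `|h^-1|%:nng.

(* A measure on the line is determined by its values on intervals, hence the
   image of the Lebesgue measure under x |-> (x - a) / h is h times it. *)
Let lebesgue_measure_affine a h (A : set (measurableTypeR R)) : 0 < h ->
  measurable A ->
  mu A = mscale (absV h) (pushforward_measure a h) A.
Proof.
move=> h0; apply: lebesgue_measure_unique => _ [[c d]] _ <-.
change (mu `]c, d] = (`|h^-1|%:E * mu (affine a h @^-1` `]c, d]))%E).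
rewrite affine_preimage// !lebesgue_measure_itv/=.
rewrite !lte_fin ltrD2l ltr_pM2l//; case: ifPn => cd; last by rewrite mule0.
rewrite ger0_norm ?invr_ge0 ?(ltW h0)// -!EFinD -EFinM; congr (_%:E).
by field; exact: lt0r_neq0.
Qed.

Lemma ge0_integral_affine a h c d (f : R -> \bar R) : 0 < h ->
  measurable_fun `]c, d[ f -> (forall x, 0 <= f x)%E ->
  (\int[mu]_(x in `](a + h * c)%R, (a + h * d)%R[) f ((x - a) / h)%R =
   h%:E * \int[mu]_(x in `]c, d[) f x)%E.
Proof.
move=> h0 mf f0.
rewrite [in RHS](@eq_measure_integral _ _ _ _
  (mscale (absV h) (pushforward_measure a h))); last first.
  by move=> A mA _; exact: lebesgue_measure_affine.
rewrite ge0_integral_mscale//=.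
have -> : (\int[pushforward_measure a h]_(x in `]c, d[) f x =
    \int[mu]_(x in affine a h @^-1` `]c, d[) f (affine a h x))%E.
  have := @ge0_integral_pushforward _ _ _ _ _ _ (measurable_affine a h) mu
    `]c, d[ f; apply => //.
rewrite affine_preimage// muleA -EFinM ger0_norm ?invr_ge0 ?(ltW h0)//.
by rewrite divff ?mul1e// lt0r_neq0.
Qed.

Lemma measurable_comp_affine a h c d f : 0 < h -> measurable_fun `]c, d[ f ->
  measurable_fun `](a + h * c), (a + h * d)[ (fun x => f ((x - a) / h)).
Proof.
move=> h0 mf; apply: (measurable_comp _ _ mf) => //.
  move=> _ [x + <-]; rewrite /= !in_itv/= ltr_pdivlMr// ltr_pdivrMr//.
  by move=> /andP[? ?]; apply/andP; split; lra.
by apply: measurable_funM => //; apply: measurable_funB.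
Qed.

Lemma L1on_affine a h c d f : 0 < h -> L1on c d f ->
  L1on (a + h * c) (a + h * d) (fun x => f ((x - a) / h)).
Proof.
move=> h0 f1; have mf := L1on_measurable f1.
apply/integrableP; split.
  by apply/measurable_EFinP; exact: measurable_comp_affine.
rewrite (ge0_integral_affine _ h0 (f := fun x => `|(f x)%:E|%E))//.
  rewrite lte_mul_pinfty ?lee_fin ?(ltW h0)//.
  by case/integrableP: f1.
by apply/measurable_EFinP/measurableT_comp.
Qed.

Lemma itvint_affine a h c d f : 0 < h -> L1on c d f ->
  itvint (a + h * c) (a + h * d) (fun x => f ((x - a) / h)) =
  h * itvint c d f.
Proof.
move=> h0 f1; have mf : measurable_fun `]c, d[ (EFin \o f).
  by case/integrableP: f1.
rewrite /itvint /Rintegral.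
transitivity (fine (h%:E * \int[mu]_(x in `]c, d[) (f x)%:E)%E); last first.
  by rewrite fineM//; exact: integrable_fin_num.
congr fine; rewrite [LHS]integralE [in RHS]integralE.
rewrite muleBr//; last first.
  by apply: fin_num_adde_defr; exact: integrable_pos_fin_num.
rewrite -!(ge0_integral_affine a h0)//=.
- by congr (_ - _)%E; apply: eq_integral => x _; rewrite ?(funeposE, funenegE).
- exact: measurable_funeneg.
- exact: measurable_funepos.
Qed.

Lemma L2on_affine a h c d f : 0 < h -> L2on c d f ->
  L2on (a + h * c) (a + h * d) (fun x => f ((x - a) / h)).
Proof.
move=> h0 [mf f2]; split; first exact: measurable_comp_affine.
exact: (L1on_affine a h0 f2).
Qed.

End AffineChange.

(** * Primitives of square-integrable functions *)

Section Primitive.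
Context {R : realType}.
Implicit Types (a b c d h x y k : R) (f g q : R -> R).
Local Notation mu := (@lebesgue_measure R).

(** In dimension one, the continuous elements of H^1(a, b) are the primitives
    of square-integrable functions. Unlike weak derivatives, primitives can be
    rescaled and glued at a common end point without test functions. *)
Definition primitive a b q g : Prop :=
  L2on a b g /\ forall x y, a <= x -> x <= y -> y <= b ->
    q y - q x = itvint x y g.

Lemma eq_primitive a b q q' g g' : (forall x, a <= x <= b -> q x = q' x) ->
  (forall x, a < x < b -> g x = g' x) -> primitive a b q g ->
    primitive a b q' g'.
Proof.
move=> qq' gg' [g2 qg]; split; first exact: eq_L2on g2.
move=> x y ax xy yb; rewrite -!qq' ?ax ?yb ?(le_trans xy)//; last first.
  by rewrite (le_trans ax xy).
rewrite qg//; apply: eq_itvint => z /andP[xz zy].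
by rewrite gg'// (le_lt_trans ax xz) (lt_le_trans zy yb).
Qed.

Lemma primitive_cst a b k : primitive a b (fun=> k) (fun=> 0).
Proof.
split; first exact: L2on_cst.
by move=> x y _ xy _; rewrite subrr itvint_cst// mul0r.
Qed.

Lemma primitive_id a b : primitive a b id (fun=> 1).
Proof.
split; first exact: L2on_cst.
by move=> x y _ xy _; rewrite itvint_cst// mul1r.
Qed.

Lemma primitiveD a b q g q' g' : primitive a b q g -> primitive a b q' g' ->
  primitive a b (fun x => q x + q' x) (fun x => g x + g' x).
Proof.
move=> [g2 qg] [g2' qg']; split; first exact: L2onD.
move=> x y ax xy yb; rewrite itvintD.
- by rewrite -qg// -qg'//; ring.
- by apply: L2on_L1; apply: L2on_sub g2.
- by apply: L2on_L1; apply: L2on_sub g2'.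
Qed.

Lemma primitiveZ a b k q g : primitive a b q g ->
  primitive a b (fun x => k * q x) (fun x => k * g x).
Proof.
move=> [g2 qg]; split; first exact: L2onZ.
move=> x y ax xy yb; rewrite itvintZ.
- by rewrite -qg// mulrBr.
- by apply: L2on_L1; apply: L2on_sub g2.
Qed.

Lemma L2on_cat a b c f : a <= b -> b <= c -> L2on a b f -> L2on b c f ->
  L2on a c f.
Proof.
move=> ab bc hf hf'; split; last by apply: L1on_cat ab bc _ _;
  [case: hf|case: hf'].
exact: L1on_measurable (L1on_cat ab bc (L2on_L1 hf) (L2on_L1 hf')).
Qed.

Lemma primitive_cat a b c q g : a <= b -> b <= c ->
  primitive a b q g -> primitive b c q g -> primitive a c q g.
Proof.
move=> ab bc [gab qab] [gbc qbc]; have gac := L2on_cat ab bc gab gbc.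
split => // x y ax xy yc.
have [yb|/ltW by'] := leP y b; first exact: qab.
have [xb|/ltW bx] := leP x b; last exact: qbc.
rewrite (itvint_cat xb by'); last by apply: L2on_L1; apply: L2on_sub gac.
by rewrite -qab// -qbc//; ring.
Qed.

Lemma primitive_affine a b q g : a < b -> primitive 0 1 q g ->
  primitive a b (fun x => q ((x - a) / (b - a)))
    (fun x => (b - a)^-1 * g ((x - a) / (b - a))).
Proof.
move=> ab [g2 qg]; set h := b - a; have h0 : 0 < h by rewrite subr_gt0.
have hn0 := lt0r_neq0 h0; split.
  apply: L2onZ; have := L2on_affine a h0 g2.
  by rewrite mulr0 addr0 mulr1 addrCA subrr addr0.
move=> x y ax xy yb.
have E z : z = a + h * ((z - a) / h) by field.
have xy' : (x - a) / h <= (y - a) / h by rewrite ler_pM2r ?invr_gt0// lerB.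
have x0 : 0 <= (x - a) / h by rewrite divr_ge0 ?subr_ge0// ltW.
have y1 : (y - a) / h <= 1 by rewrite ler_pdivrMr// mul1r lerB.
have g1 : L1on ((x - a) / h) ((y - a) / h) g.
  by apply: L2on_L1; apply: L2on_sub g2.
have := itvint_affine a h0 g1; have := L1on_affine a h0 g1.
rewrite -!E => g1' gE; rewrite itvintZ// gE qg//.
by rewrite mulrA mulVf// mul1r.
Qed.

Lemma primitive_itvint a b g : L2on a b g -> primitive a b (itvint a ^~ g) g.
Proof.
move=> g2; split => // x y ax xy yb.
rewrite (itvint_cat ax xy); first by ring.
by apply: L2on_L1; apply: L2on_sub g2.
Qed.

Lemma L1on_closed a b g : L1on a b g -> mu.-integrable `[a, b] (EFin \o g).
Proof.
move=> /integrableP[mg gfin].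
have mg' : measurable_fun `[a, b[ (EFin \o g).
  exact/emeasurable_fun_itv_obnd_cbndP.
have mg2 : measurable_fun `[a, b] (EFin \o g).
  exact/emeasurable_fun_itv_bndo_bndcP.
apply/integrableP; split => //.
rewrite -integral_itv_bndo_bndc; last exact: measurableT_comp.
by rewrite -integral_itv_obnd_cbnd//; exact: measurableT_comp.
Qed.

Lemma primitive_continuous a b q g : a <= b -> primitive a b q g ->
  {within `[a, b], continuous q}.
Proof.
move=> ab [g2 qg].
have g1 := L1on_closed (L2on_L1 g2).
apply: (@subspace_eq_continuous _ _ _ (fun x => q a + parameterized_integral mu
  a x g)).
  move=> x; rewrite inE/= in_itv/= => /andP[ax xb].
  rewrite /parameterized_integral/= itvint_cc; last first.
    by apply: L1on_measurable; apply: L1on_sub (L2on_L1 g2).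
  by rewrite -qg// addrC subrK.
move=> x; apply: cvgD; first exact: cvg_cst.
exact: (parameterized_integral_continuous ab g1).
Qed.

End Primitive.

(** * Primitives have weak derivatives *)

Section WeakDerivatives.
Context {R : realType}.
Implicit Types (a b c d h x y k K : R) (f g q phi : R -> R).
Local Notation mu := (@lebesgue_measure R).

Lemma dotL2E f g : dotL2 f g = itvint 0 1 (fun x => f x * g x).
Proof. by []. Qed.

Lemma normL2_integral f :
  normL2 f = ((\int[mu]_(x in `]0%R, 1%R[) (f x ^+ 2)%:E) `^ 2^-1)%E.
Proof.
rewrite /normL2 unlock [in RHS]integral_mkcond; congr (_ `^ _)%E.
apply: eq_integral => x _ /=; rewrite /patch.
case: ifPn => _; last by rewrite normr0 powR0.
by rewrite powR_mulrn// real_normK// num_real.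
Qed.

Lemma normL2E f : L1on 0 1 (fun x => f x ^+ 2) ->
  normL2 f = (Num.sqrt (itvint 0 1 (fun x => f x ^+ 2)))%:E.
Proof.
move=> f2; rewrite normL2_integral -[X in (X `^ _)%E]fineK; last first.
  exact: integrable_fin_num.
rewrite poweR_EFin powR12_sqrt//.
by apply: itvint_ge0 => x _; exact: sqr_ge0.
Qed.

Lemma L2P f : L2 f <-> L2on 0 1 f.
Proof.
have m01 : measurable (`]0, 1[%classic : set R) by [].
split=> [Lf|[mf f2]].
  have mf : measurable_fun `](0 : R), 1[ f.
    apply: (measurable_restrictT f m01).2.
    by move: Lf; rewrite /L2 inE => /andP[+ _]; rewrite inE.
  split => //; rewrite /L1on; apply/integrable_mkcond => //.
  have := Lfun2_integrable_sqr Lf.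
  apply: eq_integrable => // x _ /=.
  by rewrite /patch; case: ifPn => // _; rewrite expr0n.
rewrite /L2 inE; apply/andP; split; rewrite inE/=.
  exact: (measurable_restrictT f m01).1.
by rewrite /finite_norm -/(normL2 f) normL2E// ltry.
Qed.

Lemma test_boundary phi : test_function phi -> phi 0 = 0 /\ phi 1 = 0.
Proof.
move=> [_ _ cl]; split; apply/eqP; apply: contraT => n0.
  have /cl : closure [set x | phi x != 0] 0 by exact: subset_closure.
  by rewrite /= in_itv/= ltxx.
have /cl : closure [set x | phi x != 0] 1 by exact: subset_closure.
by rewrite /= in_itv/= ltxx andbF.
Qed.

Lemma test_continuous phi : test_function phi -> continuous phi.
Proof.
move=> [d _ _] x; apply: differentiable_continuous; exact/derivable1_diffP.
Qed.

Lemma C1_primitive phi a b : (forall x, derivable phi x 1) ->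
  continuous (derive1 phi) -> primitive a b phi (derive1 phi).
Proof.
move=> dphi cphi; split.
  by apply: L2on_continuous; exact: continuous_subspaceT.
move=> x y ax; rewrite le_eqVlt => /predU1P[->|xy] yb.
  by rewrite subrr itvintxx.
have cf : continuous phi.
  by move=> z; apply: differentiable_continuous; exact/derivable1_diffP.
have := @continuous_FTC2 R (derive1 phi) phi x y xy.
have -> : (\int[mu]_(x in `[x, y]) (derive1 phi x)%:E)%E =
    (itvint x y (derive1 phi))%:E.
  rewrite -itvint_cc; last first.
    by apply: continuous_measurable_itv; exact: continuous_subspaceT.
  rewrite /Rintegral fineK//; apply: integrable_fin_num => //.
  apply: continuous_compact_integrable; first exact: segment_compact.
  exact: continuous_subspaceT.
rewrite -EFinD => h; apply/esym/EFin_inj/h; last by [].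
- exact: continuous_subspaceT.
- split; first by move=> z _; exact: dphi.
    exact/cvg_at_right_filter/cf.
  exact/cvg_at_left_filter/cf.
Qed.

(** Summing the hypothesis over the N cells of a uniform subdivision bounds the
    increment of F by K (G 1 - G 0) / N; then N tends to infinity. *)
Lemma increment0_of_superlinear (F G : R -> R) K :
  (forall x y, 0 <= x -> x <= y -> y <= 1 ->
    `|F y - F x| <= K * (y - x) * (G y - G x)) -> F 1 = F 0.
Proof.
move=> FG; apply/eqP; rewrite -subr_eq0 -normr_le0 leNgt; apply/negP => d0.
have bnd N : `|F 1 - F 0| * N.+1%:R <= K * (G 1 - G 0).
  have N0 : 0 < N.+1%:R :> R by [].
  suff: forall m, (m <= N.+1)%N -> `|F (m%:R / N.+1%:R) - F 0| * N.+1%:R <=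
      K * (G (m%:R / N.+1%:R) - G 0).
    by move=> /(_ _ (leqnn _)); rewrite divff ?gt_eqF.
  elim=> [_|m IH mN]; first by rewrite !mul0r !subrr normr0 mul0r mulr0.
  set y := m.+1%:R / N.+1%:R; set x := m%:R / N.+1%:R in IH *.
  have yx : (y - x) * N.+1%:R = 1.
    by rewrite /x /y -mulrBl divfK ?gt_eqF// -natrB ?leqnSn// subSnn.
  have xy : x <= y by rewrite /x /y ler_pM2r ?invr_gt0// ler_nat.
  have x0 : 0 <= x by rewrite divr_ge0.
  have y1 : y <= 1 by rewrite ler_pdivrMr// mul1r ler_nat.
  have := FG x y x0 xy y1; have {IH} := IH (ltnW mN).
  move=> IH; rewrite -(ler_pM2r N0) => FGxy.
  have : `|F y - F 0| <= `|F y - F x| + `|F x - F 0|.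
    by rewrite (le_trans _ (ler_normD _ _))// addrA subrK.
  rewrite -(ler_pM2r N0) => /le_trans; apply; rewrite mulrDl.
  rewrite (le_trans (lerD FGxy IH))//.
  have -> : K * (y - x) * (G y - G x) * N.+1%:R =
      K * (G y - G x) * ((y - x) * N.+1%:R) by ring.
  by rewrite yx mulr1 -mulrDr addrA subrK.
pose N := Num.bound `|K * (G 1 - G 0) / `|F 1 - F 0| |.
have : K * (G 1 - G 0) / `|F 1 - F 0| < N.+1%:R.
  rewrite (le_lt_trans (ler_norm _))//.
  by rewrite (lt_trans (archi_boundP (normr_ge0 _)))// ltr_nat.
by rewrite ltr_pdivrMr// [ltRHS]mulrC => /(le_lt_trans (bnd N)); rewrite ltxx.
Qed.

(** Integration by parts against a C^1 function. The increment over [x, y] of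
    the defect F of the formula is the integral of
    g t (phi y - phi t) + (q x - q t) phi' t; if L bounds |phi'|, it is at most
    2 L (y - x) times the integral of |g| over [x, y], so that F is constant. *)
Lemma primitive_ibp q g phi : primitive 0 1 q g ->
  (forall x, derivable phi x 1) ->
  continuous (derive1 phi) ->
  itvint 0 1 (fun x => q x * derive1 phi x + g x * phi x) =
  q 1 * phi 1 - q 0 * phi 0.
Proof.
move=> qg dphi cphi; have phiP := C1_primitive 0 1 dphi cphi.
have phic : continuous phi.
  by move=> z; apply: differentiable_continuous; exact/derivable1_diffP.
have [L L0 phiL] : exists2 L, 0 < L & forall x, 0 <= x <= 1 ->
  `|derive1 phi x| <= L.
  by apply: continuous_bounded; exact: continuous_subspaceT.
have mphi (a b : R) : measurable_fun `]a, b[ phi.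
  by apply: continuous_measurable_itv; exact: continuous_subspaceT.
have mdphi (a b : R) : measurable_fun `]a, b[ (derive1 phi).
  by apply: continuous_measurable_itv; exact: continuous_subspaceT.
have qc := primitive_continuous ler01 qg.
case: qg phiP => [g2 qg] [_ phiP].
have q1 := L1on_continuous qc; have g1 := L2on_L1 g2.
have [Lp _ phiLp] : exists2 L, 0 < L & forall x, 0 <= x <= 1 -> `|phi x| <= L.
  by apply: continuous_bounded; exact: continuous_subspaceT.
have i1 : L1on 0 1 (fun x => q x * derive1 phi x).
  by apply: (L1onM_bounded (K := L)) => // x /andP[? ?]; rewrite phiL// !ltW.
have i2 : L1on 0 1 (fun x => g x * phi x).
  by apply: (L1onM_bounded (K := Lp)) => // x /andP[? ?]; rewrite phiLp// !ltW.
have i3 := L1onD i1 i2.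
pose F x := q x * phi x - itvint 0 x (fun x => q x * derive1 phi x + g x * phi
  x).
suff : F 1 = F 0 by rewrite /F itvintxx => E; lra.
apply: (@increment0_of_superlinear F (fun x => itvint 0 x (fun t => `|g t|)) (2
  * L)).
move=> x y x0 xy y1; have gxy : L1on x y g by exact: L1on_sub g1.
have g0y : L1on 0 y g by exact: L1on_sub g1.
rewrite /F (itvint_cat x0 xy); last exact: L1on_sub i3.
rewrite (itvint_cat x0 xy (f := fun t => `|g t|)); last exact: L1on_norm.
rewrite [X in _ <= _ * X]addrAC subrr add0r.
have lip t : x < t < y -> `|phi y - phi t| <= L * (y - x).
  move=> /andP[xt ty]; rewrite phiP ?(ltW ty)//; last exact: le_trans (ltW xt).
  have dL1 : L1on t y (derive1 phi).
    by apply: L1on_continuous; exact: continuous_subspaceT.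
  rewrite (le_trans (normr_itvint_le (K := L) _ dL1 _)) ?(ltW ty)//.
    move=> s /andP[ts sy]; rewrite phiL//.
    by rewrite (le_trans x0 (ltW (lt_trans xt ts))) (le_trans (ltW sy)).
  by rewrite ler_wpM2l ?(ltW L0)// lerB// ltW.
pose E t := g t * (phi y - phi t) + (q x - q t) * derive1 phi t.
have dphixy : L1on x y (derive1 phi).
  by apply: L1on_continuous; exact: continuous_subspaceT.
have EE : E = (fun t => (phi y * g t + q x * derive1 phi t) -
    (q t * derive1 phi t + g t * phi t)).
  by apply/funext => t; rewrite /E; ring.
have E1 : L1on x y E.
  rewrite EE; apply: L1onB; last exact: L1on_sub i3.
  by apply: L1onD; exact: L1onZ.
have -> : q y * phi y - (itvint 0 x (fun x1 => q x1 * derive1 phi x1 + g x1 *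
  phi x1) +
    itvint x y (fun x1 => q x1 * derive1 phi x1 + g x1 * phi x1)) -
    (q x * phi x - itvint 0 x (fun x1 => q x1 * derive1 phi x1 + g x1 * phi
      x1)) =
    itvint x y E.
  rewrite EE itvintB; [|by apply: L1onD; exact: L1onZ|exact: L1on_sub i3].
  have Zg := L1onZ (phi y) gxy; have Zphi := L1onZ (q x) dphixy.
  rewrite (itvintD Zg Zphi) !itvintZ// -phiP// -qg//; ring.
set Gxy := itvint x y (fun t => `|g t|).
have gn : L1on x y (fun t => `|g t|) by exact: L1on_norm.
rewrite (le_trans (normr_itvint E1))//.
have -> : 2 * L * (y - x) * Gxy =
    itvint x y (fun t => L * (y - x) * `|g t| + L * Gxy).
  rewrite itvintD; [|exact: L1onZ|exact: L1on_cst].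
  by rewrite itvintZ// itvint_cst// -/Gxy; ring.
apply: le_itvint; first exact: L1on_norm.
  by apply: L1onD; [exact: L1onZ|exact: L1on_cst].
move=> t /[dup] xty /andP[xt ty]; rewrite /E (le_trans (ler_normD _ _))//.
rewrite !normrM; apply: lerD; first by rewrite mulrC ler_wpM2r// lip.
have t1 : t <= 1 by rewrite (le_trans (ltW ty)).
have gxt : L1on x t g by apply: L1on_sub gxy => //; exact: ltW.
rewrite mulrC ler_pM// ?phiL ?t1 ?(le_trans x0 (ltW xt))//.
rewrite distrC qg ?(ltW xt)// (le_trans (normr_itvint gxt))//.
rewrite /Gxy (itvint_cat (ltW xt) (ltW ty))// lerDl.
by apply: itvint_ge0.
Qed.

Lemma primitive_weak_deriv q g : primitive 0 1 q g -> is_weak_deriv q g.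
Proof.
move=> qg phi tphi; have [phi0 phi1] := test_boundary tphi.
have phic := test_continuous tphi.
case: tphi => dphi cphi _; have := primitive_ibp qg dphi cphi.
have qc := primitive_continuous ler01 qg.
have i1 : L1on 0 1 (fun x => q x * derive1 phi x).
  apply: L2onM; first exact: L2on_continuous.
  by apply: L2on_continuous; exact: continuous_subspaceT.
have i2 : L1on 0 1 (fun x => g x * phi x).
  apply: L2onM; first by case: qg.
  by apply: L2on_continuous; exact: continuous_subspaceT.
rewrite itvintD// phi0 phi1 !mulr0 subrr !dotL2E => /eqP.
by rewrite addr_eq0 => /eqP.
Qed.

Lemma primitive_H1 q g : primitive 0 1 q g -> H1 q.
Proof.
move=> qg; split.
  by apply/L2P/L2on_continuous; exact: (primitive_continuous ler01 qg).
exists g; split; last exact: primitive_weak_deriv.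
by apply/L2P; case: qg.
Qed.

End WeakDerivatives.

(** * The lemma of du Bois-Reymond *)

Section DuBoisReymond.
Context {R : realType}.
Implicit Types (a b c d h s t x y k K : R) (f g q w phi : R -> R).
Local Notation mu := (@lebesgue_measure R).

(** A form of differentiability, with derivative f', which passes to
    differences, multiples and translates by the triangle inequality. *)
Definition quadratic_approx f f' K : Prop :=
  forall x h, `|f (h + x) - f x - h * f' x| <= K * h ^+ 2.

Lemma quadratic_approx_derive f f' K x : quadratic_approx f f' K ->
  derivable f x 1 /\ derive1 f x = f' x.
Proof.
move=> /(_ x) fK; set k := f' x in fK *.
have K0 : 0 <= K.
  by have := fK 1; rewrite expr1n mulr1; apply: le_trans.
have cv : h^-1 *: (f (h + x) - f x) @[h --> 0^'] --> k.
  apply/cvgrPdist_le => e e0; near=> h.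
  have h0 : h != 0 by near: h; exact: nbhs_dnbhs_neq.
  have -> : k - h^-1 *: (f (h + x) - f x) = - (h^-1 * (f (h + x) - f x - h *
    k)).
    by rewrite /GRing.scale/=; field.
  rewrite normrN normrM normfV ler_pdivrMl ?normr_gt0// (le_trans (fK h))//.
  rewrite -real_normK ?num_real// expr2 mulrCA ler_wpM2l//.
  have : `|h| < e / (K + 1).
    by near: h; apply: dnbhs0_lt; rewrite divr_gt0// ltr_wpDl.
  rewrite ltr_pdivlMr ?ltr_wpDl// => /ltW; apply: le_trans.
  by rewrite mulrDr mulr1 mulrC lerDl.
split; last by apply/cvg_lim.
apply/cvg_ex; exists k.
rewrite [X in X @ _ --> _](_ : _ = (fun h => h^-1 *: (f (h + x) - f x))) //.
by apply/funext => h /=; rewrite /GRing.scale/= mulr1.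
Unshelve. all: by end_near. Qed.

Lemma quadratic_approxB f f' K g g' K' : quadratic_approx f f' K ->
  quadratic_approx g g' K' ->
  quadratic_approx (fun x => f x - g x) (fun x => f' x - g' x) (K + K').
Proof.
move=> fK gK x h; rewrite (_ : _ - _ - _ = (f (h + x) - f x - h * f' x) -
  (g (h + x) - g x - h * g' x)); last by ring.
by rewrite (le_trans (ler_normB _ _))// mulrDl lerD.
Qed.

Lemma quadratic_approxZ k f f' K : quadratic_approx f f' K ->
  quadratic_approx (fun x => k * f x) (fun x => k * f' x) (`|k| * K).
Proof.
move=> fK x h; rewrite (_ : _ - _ - _ = k * (f (h + x) - f x - h * f' x));
  last by ring.
by rewrite normrM -mulrA ler_wpM2l.
Qed.

Lemma quadratic_approx_shift c f f' K : quadratic_approx f f' K ->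
  quadratic_approx (fun x => f (x - c)) (fun x => f' (x - c)) K.
Proof. by move=> fK x h; have := fK (x - c) h; rewrite addrA. Qed.

(** The positive part. *)
Definition pos x : R := (x + `|x|) / 2.

Lemma pos_ge0 x : 0 <= x -> pos x = x.
Proof. by move=> x0; rewrite /pos ger0_norm//; lra. Qed.

Lemma pos_le0 x : x <= 0 -> pos x = 0.
Proof. by move=> x0; rewrite /pos ler0_norm//; lra. Qed.

Lemma pos_continuous : continuous pos.
Proof.
move=> x; apply: cvgM; last exact: cvg_cst.
by apply: cvgD; [exact: cvg_id|exact: norm_continuous].
Qed.

(** The C^1 primitive of the positive part. *)
Definition hsqpos x : R := 2^-1 * pos x ^+ 2.

Lemma hsqpos_approx : quadratic_approx hsqpos pos 1.
Proof.
move=> x h; rewrite mul1r /hsqpos.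
rewrite ler_norml; apply/andP; split;
case: (lerP (h + x) 0) => hx; case: (lerP x 0) => x0;
rewrite ?(pos_le0 hx) ?(pos_le0 x0) ?(pos_ge0 (ltW hx)) ?(pos_ge0 (ltW x0));
  nra.
Qed.

(** For d > 0, the continuous function which is 0 before 0, 1 after d
    and affine in between, and its C^1 primitive. *)
Definition ramp d t : R := d^-1 * (pos t - pos (t - d)).
Definition iramp d t : R := d^-1 * (hsqpos t - hsqpos (t - d)).

Lemma iramp_approx d : quadratic_approx (iramp d) (ramp d) (`|d^-1| * (1 + 1)).
Proof.
apply: quadratic_approxZ; apply: quadratic_approxB; first exact: hsqpos_approx.
by apply: quadratic_approx_shift; exact: hsqpos_approx.
Qed.

Lemma ramp_le0 d t : 0 < d -> t <= 0 -> ramp d t = 0.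
Proof. by move=> d0 t0; rewrite /ramp !pos_le0 ?subrr ?mulr0//; lra. Qed.

Lemma ramp_ge d t : 0 < d -> d <= t -> ramp d t = 1.
Proof.
move=> d0 dt; rewrite /ramp !pos_ge0; [|lra|lra].
by rewrite opprB addrCA subrr addr0 mulVf// gt_eqF.
Qed.

Lemma iramp_le0 d t : 0 < d -> t <= 0 -> iramp d t = 0.
Proof.
move=> d0 t0; rewrite /iramp /hsqpos !pos_le0;
  [by rewrite expr0n !mulr0 subrr mulr0|lra|lra].
Qed.

Lemma iramp_ge d t : 0 < d -> d <= t -> iramp d t = t - 2^-1 * d.
Proof.
move=> d0 dt; rewrite /iramp /hsqpos !pos_ge0; [|lra|lra].
by field; rewrite gt_eqF.
Qed.

Lemma ramp_continuous d : continuous (ramp d).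
Proof.
move=> x; apply: cvgM; first exact: cvg_cst.
apply: cvgB; first exact: pos_continuous.
apply: (@continuous_comp _ _ _ (fun t => t - d) pos);
  last exact: pos_continuous.
by apply: cvgB; [exact: cvg_id|exact: cvg_cst].
Qed.

Lemma ramp_shift_continuous d c : continuous (fun x => ramp d (x - c)).
Proof.
move=> x; apply: (@continuous_comp _ _ _ (fun t => t - c) (ramp d)).
  by apply: cvgB; [exact: cvg_id|exact: cvg_cst].
exact: ramp_continuous.
Qed.

Lemma ramp_bounded d t : 0 < d -> `|ramp d t| <= 1.
Proof.
move=> d0; have [t0|t0] := leP t 0; first by rewrite ramp_le0// normr0.
have [dt|td] := leP d t; first by rewrite ramp_ge// normr1.
rewrite /ramp pos_ge0 ?(ltW t0)// pos_le0 ?subr0; last by rewrite subr_le0 ltW.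
rewrite ger0_norm; first by rewrite mulrC ler_pdivrMr// mul1r ltW.
by rewrite mulr_ge0// ?invr_ge0 ltW.
Qed.

(** A continuous approximation of the indicator of ]a, a + h], and its C^1
    primitive, which is equal to h on the right of a + h + d. *)
Definition plateau a h d x : R := ramp d (x - a) - ramp d (x - (a + h)).
Definition iplateau a h d x : R := iramp d (x - a) - iramp d (x - (a + h)).

(** On the right of both plateaus the two primitives are equal to h, so that
    their difference has compact support. *)
Lemma plateau_test a b h d : 0 < a -> 0 < b -> 0 <= h -> 0 < d ->
  a + h + d < 1 -> b + h + d < 1 ->
  test_function (fun x => iplateau a h d x - iplateau b h d x) /\
  derive1 (fun x => iplateau a h d x - iplateau b h d x) =
    (fun x => plateau a h d x - plateau b h d x).
Proof.
move=> a0 b0 h0 d0 a1 b1.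
set phi := fun x => _; set phi' := (RHS).
have approx : exists K, quadratic_approx phi phi' K.
  have sh c : exists K, quadratic_approx (fun x => iramp d (x - c)) (fun x =>
    ramp d (x - c)) K.
    by eexists; apply: quadratic_approx_shift; exact: iramp_approx.
  have [K1 h1] := sh a; have [K2 h2] := sh (a + h).
  have [K3 h3] := sh b; have [K4 h4] := sh (b + h).
  by eexists; apply: quadratic_approxB; apply: quadratic_approxB; eassumption.
case: approx => K approx.
have dphi x : derivable phi x 1 /\ derive1 phi x = phi' x.
  exact: quadratic_approx_derive approx.
have dE : derive1 phi = phi' by apply/funext => x; case: (dphi x).
split; last exact: dE.
split.
- by move=> x; case: (dphi x).
- rewrite dE => x; apply: cvgB; apply: cvgB; exact: ramp_shift_continuous.
- pose m := Num.min a b; pose M := Num.max a b + h + d.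
  have m0 : 0 < m by rewrite lt_min a0.
  have M1 : M < 1 by rewrite /M; case: (leP a b).
  have sub : [set x | phi x != 0] `<=` `[m, M].
    move=> x /= /eqP xn0; rewrite in_itv/= leNgt [X in _ && X]leNgt -negb_or.
    apply/negP => /orP[xm|Mx]; apply: xn0.
      have xa : x < a by rewrite (lt_le_trans xm)// ge_min lexx.
      have xb : x < b by rewrite (lt_le_trans xm)// ge_min lexx orbT.
      by rewrite /phi /iplateau !iramp_le0 ?subrr//; lra.
    have Max : a + h + d < x by rewrite (le_lt_trans _ Mx)// !lerD2r le_max
      lexx.
    have Mbx : b + h + d < x by rewrite (le_lt_trans _ Mx)// !lerD2r le_max
      lexx orbT.
    by rewrite /phi /iplateau !iramp_ge; lra.
  have cl : closed (`[m, M]%classic : set R) by exact: interval_closed.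
  move=> x /(closure_subset sub); rewrite -((closure_id _).1 cl).
  by rewrite /= !in_itv/= => /andP[mx xM];
    rewrite (lt_le_trans m0 mx) (le_lt_trans xM M1).
Qed.

Lemma measurable_step a c e : measurable_fun `]c,
  e[ (fun x : R => (a < x)%R%:R : R).
Proof.
rewrite (_ : (fun x => _) = \1_(`]a, +oo[%classic : set R)).
  exact: measurable_funTS.
by apply/funext => x; rewrite indicE mem_setE in_itv/= andbT.
Qed.

Lemma itvint_mul_step w a : L1on 0 1 w -> 0 <= a <= 1 ->
  itvint 0 1 (fun x => w x * (a < x)%R%:R) = itvint a 1 w.
Proof.
move=> w1 /andP[a0 a1].
have mstep := measurable_step a.
rewrite (itvint_cat a0 a1); last first.
  apply: (L1onM_bounded (K := 1)) => // x _.
  by case: (a < x); rewrite ?normr1 ?normr0.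
rewrite (@eq_itvint _ 0 a _ (fun=> 0)); last first.
  by move=> x /andP[_ xa]; rewrite ltNge (ltW xa) mulr0.
rewrite itvint_cst// mul0r add0r; apply: eq_itvint => x /andP[ax _].
by rewrite ax mulr1.
Qed.

(** The ramps of width d / (n + 1) tend pointwise to the indicator of
    ]a, +oo[ and are bounded by 1. *)
Lemma itvint_ramp_cvg w a d : L1on 0 1 w -> 0 <= a <= 1 -> 0 < d ->
  itvint 0 1 (fun x => w x * ramp (d / n.+1%:R) (x - a)) @[n --> \oo] -->
  itvint a 1 w.
Proof.
move=> w1 a01 d0; rewrite -itvint_mul_step//.
have dn0 n : 0 < d / n.+1%:R by rewrite divr_gt0.
have mw := L1on_measurable w1.
have mramp n : measurable_fun `](0 : R),
  1[ (fun x => ramp (d / n.+1%:R) (x - a)).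
  apply: continuous_measurable_itv; apply: continuous_subspaceT.
  exact: ramp_shift_continuous.
have mstep := measurable_step a.
pose f_ n x := (w x * ramp (d / n.+1%:R) (x - a))%:E.
pose f x := (w x * (a < x)%R%:R)%:E.
have mf_ n : measurable_fun `](0 : R), 1[ (f_ n).
  by apply/measurable_EFinP; exact: measurable_funM.
have mf : measurable_fun `](0 : R), 1[ f.
  by apply/measurable_EFinP; exact: measurable_funM.
have f_f : {ae mu, forall x, `](0 : R), 1[%classic x -> f_ ^~ x @ \oo --> f x}.
  apply/aeW => x _; apply: cvg_near_cst; rewrite /f_ /f.
  have [xa|ax] := leP x a.
    by near=> n; rewrite ramp_le0// subr_le0.
  have xa0 : 0 < x - a by rewrite subr_gt0.
  near=> n; rewrite ramp_ge// ler_pdivrMr// mulrC -ler_pdivrMr//.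
  by rewrite (@le_trans _ _ n%:R) ?ler_nat//; near: n; exact: nbhs_infty_ger.
have f_w : {ae mu, forall x n, `](0 : R), 1[%classic x ->
  (`|f_ n x| <= `|w x|%:E)%E}.
  apply/aeW => x n _; rewrite lee_fin normrM -[leRHS]mulr1 ler_wpM2l//.
  exact: ramp_bounded.
have [i1 _ cv] := @dominated_convergence _ _ R mu _ (measurable_itv _) f_ f _
  mf_ mf f_f (L1on_norm w1) f_w.
apply: fine_cvg; rewrite fineK//.
exact: integrable_fin_num.
Unshelve. all: by end_near. Qed.

Definition weak_deriv0 w : Prop :=
  forall phi, test_function phi ->
    itvint 0 1 (fun x => w x * derive1 phi x) = 0.

(** Testing with the difference of two plateaus, which tends to the difference
    of the indicators of ]a, a + h] and ]b, b + h]. *)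
Lemma weak_deriv0_translate w a b h : L1on 0 1 w -> weak_deriv0 w ->
  0 < a -> 0 < b -> 0 <= h -> a + h < 1 -> b + h < 1 ->
  itvint a (a + h) w = itvint b (b + h) w.
Proof.
move=> w1 w0 a0 b0 h0 a1 b1.
pose d := (1 - (Num.max a b + h)) / 2.
have d0 : 0 < d by rewrite divr_gt0// subr_gt0; case: (leP a b).
have dn0 n : 0 < d / n.+1%:R by rewrite divr_gt0.
have dnd n : d / n.+1%:R <= d by rewrite ler_pdivrMr// ler_peMr ?(ltW d0)//
  ler1n.
have ad : a + h + d < 1.
  by rewrite /d; case: (leP a b) => ab; lra.
have bd : b + h + d < 1.
  by rewrite /d; case: (leP a b) => ab; lra.
have wr n c : L1on 0 1 (fun x => w x * ramp (d / n.+1%:R) (x - c)).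
  apply: (L1onM_bounded (K := 1)) => //; last by move=> x _;
    exact: ramp_bounded.
  apply: continuous_measurable_itv; apply: continuous_subspaceT.
  exact: ramp_shift_continuous.
pose I c n := itvint 0 1 (fun x => w x * ramp (d / n.+1%:R) (x - c)).
have I0 n : I a n - I (a + h) n - (I b n - I (b + h) n) = 0.
  rewrite /I -!itvintB//; last 2 first.
  - by apply: L1onB.
  - by apply: L1onB.
  have [tphi dphi] := plateau_test a0 b0 h0 (dn0 n)
    (le_lt_trans (lerD (lexx _) (dnd n)) ad) (le_lt_trans (lerD (lexx _) (dnd
      n)) bd).
  have := w0 _ tphi; rewrite dphi; apply: etrans.
  by apply: eq_itvint => x _; rewrite /plateau; ring.
have cI c : 0 <= c <= 1 -> I c @ \oo --> itvint c 1 w.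
  by move=> c01; exact: itvint_ramp_cvg.
have c0 : (fun n => I a n - I (a + h) n - (I b n - I (b + h) n)) @ \oo --> 
   itvint a 1 w - itvint (a + h) 1 w - (itvint b 1 w - itvint (b + h) 1 w).
  apply: cvgB; apply: cvgB; apply: cI; lra.
have c0' : (fun n => I a n - I (a + h) n - (I b n - I (b + h) n)) @ \oo --> (0
  : R).
  by rewrite (_ : (fun n => _) = (fun=> 0)); [exact: cvg_cst|exact/funext].
have : itvint a 1 w - itvint (a + h) 1 w -
    (itvint b 1 w - itvint (b + h) 1 w) = 0 :> R.
  by rewrite -(cvg_lim (@Rhausdorff R) c0) (cvg_lim (@Rhausdorff R) c0').
have -> : itvint a 1 w = itvint a (a + h) w + itvint (a + h) 1 w.
  by apply: itvint_cat; [lra|lra|apply: L1on_sub w1; lra].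
have -> : itvint b 1 w = itvint b (b + h) w + itvint (b + h) 1 w.
  by apply: itvint_cat; [lra|lra|apply: L1on_sub w1; lra].
by move=> e; lra.
Qed.

(** By translation invariance the increments F (x + h) - F x and
    F (y + h) - F y agree for all small h of either sign. *)
Lemma weak_deriv0_derive w (F : R -> R) x y : L1on 0 1 w -> weak_deriv0 w ->
  (forall z, 0 < z < 1 -> F z = itvint 0 z w) -> 0 < x < 1 -> 0 < y < 1 ->
  derive1 F x = derive1 F y.
Proof.
move=> w1 w0 FE; wlog xy : x y / x <= y.
  move=> wl x01 y01; have [xy|/ltW yx] := leP x y; first exact: wl.
  by apply/esym/wl.
move=> /andP[x0 x1] /andP[y0 y1].
have incr h : 0 < h + x -> h + y < 1 -> F (h + x) - F x = F (h + y) - F y.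
  move=> hx hy; rewrite !FE; [|lra..].
  have [h0|/ltW h0] := leP 0 h.
    rewrite (@itvint_cat _ 0 x (h + x)); [|lra|lra|by apply: L1on_sub w1; lra].
    rewrite (@itvint_cat _ 0 y (h + y)); [|lra|lra|by apply: L1on_sub w1; lra].
    have := @weak_deriv0_translate w x y h w1 w0 x0 y0 h0.
    rewrite ![_ + h]addrC => ->; [ring|lra|lra].
  rewrite (@itvint_cat _ 0 (h + x) x); [|lra|lra|by apply: L1on_sub w1; lra].
  rewrite (@itvint_cat _ 0 (h + y) y); [|lra|lra|by apply: L1on_sub w1; lra].
  have := @weak_deriv0_translate w (h + x) (h + y) (- h) w1 w0 hx.
  rewrite ![_ - h]addrC !addKr => ->; [ring|lra|lra|lra|lra].
rewrite /derive1.
suff -> : h^-1 *: (F (h + x) - F x) @[h --> 0^'] =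
          h^-1 *: (F (h + y) - F y) @[h --> 0^'] by [].
have near0 : \forall h \near 0^',
  h^-1 *: (F (h + x) - F x) = h^-1 *: (F (h + y) - F y).
  near=> h; rewrite incr//.
    have : `|h| < x by near: h; exact: dnbhs0_lt.
    by rewrite ltr_norml => /andP[]; lra.
  have : `|h| < 1 - y by near: h; apply: dnbhs0_lt; rewrite subr_gt0.
  by rewrite ltr_norml => /andP[]; lra.
apply/seteqP; split; apply: near_eq_cvg => //.
by apply: filterS near0 => h ->.
Unshelve. all: by end_near. Qed.

(** Near x the open interval and the restriction of w can be replaced by the
    closed interval and the extension of w by 0. *)
Lemma derive1_itvint w x k : L1on 0 1 w -> 0 < x < 1 ->
  derive1 (parameterized_integral mu 0 ^~ (w \_ `]0, 1[)) x = k ->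
  derive1 (fun z => itvint 0 z w) x = k.
Proof.
move=> w1 /andP[x0 x1] <-; rewrite !derive1E; apply: near_eq_derive.
near=> z; have z0 : 0 < z by near: z; exact: lt_nbhsr.
have z1 : z < 1 by near: z; exact: lt_nbhsl.
rewrite /parameterized_integral itvint_cc.
  apply: eq_itvint => t /andP[t0 tz]; rewrite patchE mem_set//=.
  by rewrite in_itv/= t0 (lt_trans tz z1).
apply: eq_measurable_itv (L1on_measurable (L1on_sub (lexx 0) (ltW z1) w1)).
move=> t /andP[t0 tz]; rewrite patchE mem_set//=.
by rewrite in_itv/= t0 (lt_trans tz z1).
Unshelve. all: by end_near. Qed.

Lemma ae_weaken (P Q : R -> Prop) : (forall x, P x -> Q x) ->
  {ae mu, forall x, P x} -> {ae mu, forall x, Q x}.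
Proof.
by move=> PQ; apply: filterS => //; exact: (ae_filter_ringOfSetsType mu).
Qed.

Lemma ae_and (P Q : R -> Prop) : {ae mu, forall x, P x} ->
  {ae mu, forall x, Q x} -> {ae mu, forall x, P x /\ Q x}.
Proof.
by move=> aP aQ; apply: (@filterI _ _ (ae_filter_ringOfSetsType mu)).
Qed.

Lemma L1on_restrict w a b : L1on a b w ->
  mu.-integrable setT (EFin \o (w \_ `]a, b[)).
Proof.
rewrite /L1on -restrict_EFin => h.
have [+ _] := @integrable_mkcond _ _ R mu _ (EFin \o w) (measurable_itv `]a,
  b[).
exact.
Qed.

Lemma ftc_ae w : L1on 0 1 w ->
  {ae mu, forall x, 0 < x < 1 -> derive1 (fun z => itvint 0 z w) x = w x}.
Proof.
move=> w1; have iw : mu.-integrable setT (EFin \o (w \_ `](0 : R), 1[)).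
  exact: L1on_restrict.
have := @FTC1 R (w \_ `]0, 1[) (BLeft 0).
have h1 y : mu.-integrable [set` Interval (BLeft 0) (BRight y)] (EFin \o (w \_
  `]0, 1[)).
  by apply: integrableS iw.
have h2 : locally_integrable [set: R] (w \_ `]0, 1[).
  by apply: integrable_locally.
move=> /(_ h1 h2); apply: ae_weaken => x /= h x01.
apply: derive1_itvint => //.
have [|_ ->] := h; first by case/andP: x01 => x0 _; exact: x0.
by rewrite patchE mem_set//= in_itv.
Qed.

Lemma ftc_continuous_itv w x : {within `[0, 1], continuous w} -> 0 < x < 1 ->
  derive1 (fun z => itvint 0 z w) x = w x.
Proof.
move=> wc x01; have w1 := L1on_continuous wc.
apply: derive1_itvint => //; case/andP: (x01) => x0 x1.
have iw : mu.-integrable setT (EFin \o (w \_ `](0 : R), 1[)).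
  exact: L1on_restrict.
have cw : {for x, continuous (w \_ `]0, 1[)}.
  have wx : {for x, continuous w}.
    have [ci _ _] := (continuous_within_itvP _ ltr01).1 wc.
    by apply: ci; rewrite in_itv/= x0.
  rewrite /prop_for /continuous_at patchE mem_set/= ?in_itv/= ?x0 ?x1//.
  apply: cvg_trans wx; apply: near_eq_cvg; near=> z.
  rewrite patchE mem_set//= in_itv/=; apply/andP; split.
    by near: z; exact: lt_nbhsr.
  by near: z; exact: lt_nbhsl.
have [|_ ->] := @continuous_FTC1_closed R (w \_ `]0, 1[) 0 x 1 x1 _ x0 cw.
- by apply: integrableS iw.
- by rewrite patchE mem_set//= in_itv.
Unshelve. all: by end_near. Qed.

Lemma continuous_cst_closure w a b k : a < b ->
  {within `[a, b], continuous w} ->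
  (forall x, a < x < b -> w x = k) -> forall x, a <= x <= b -> w x = k.
Proof.
move=> ab wc wk; have [_ c0 c1] := (continuous_within_itvP _ ab).1 wc.
have e0 : w a = k.
  rewrite -(cvg_lim (@Rhausdorff R) c0); apply: cvg_lim => //;
    apply: cvg_near_cst.
  by near=> z; apply: wk => //; apply/andP; split.
have e1 : w b = k.
  rewrite -(cvg_lim (@Rhausdorff R) c1); apply: cvg_lim => //;
    apply: cvg_near_cst.
  by near=> z; apply: wk => //; apply/andP; split.
move=> x /andP[]; rewrite le_eqVlt => /predU1P[<-//|ax].
rewrite le_eqVlt => /predU1P[->//|xb].
by apply: wk; rewrite ax.
Unshelve. all: by end_near. Qed.

(** A continuous w is the derivative of its integral at every interior point,
    so that all its interior values agree. *)
Lemma weak_deriv0_continuous w : {within `[0, 1], continuous w} ->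
  weak_deriv0 w ->
  forall x, 0 <= x <= 1 -> w x = w 0.
Proof.
move=> wc w0; have w1 := L1on_continuous wc.
have cst x y : 0 < x < 1 -> 0 < y < 1 -> w x = w y.
  move=> x01 y01; rewrite -(ftc_continuous_itv wc x01) -(ftc_continuous_itv wc
    y01).
  exact: (weak_deriv0_derive w1 w0).
have h01 : 0 < (2^-1 : R) < 1 by lra.
have h := continuous_cst_closure ltr01 wc (fun x x01 => cst x _ x01 h01).
by move=> x /h ->; rewrite h// lexx ler01.
Qed.

(** Lebesgue's differentiation theorem replaces continuity: the values of w
    agree at any two points where w is the derivative of its integral. *)
Lemma weak_deriv0_ae w : L1on 0 1 w -> weak_deriv0 w ->
  exists k, {ae mu, forall x, 0 < x < 1 -> w x = k}.
Proof.
move=> w1 w0; have wae := ftc_ae w1.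
have [x0 [x01 wx0]] : exists x,
  0 < x < 1 /\ derive1 (fun z => itvint 0 z w) x = w x.
  apply: contrapT => /forallNP h.
  have [N [mN N0 sub]] := wae.
  have : (mu `]0%R, 1%R[ <= mu N)%E.
    apply: le_measure; rewrite ?inE//.
    move=> x /=; rewrite in_itv/= => x01; apply: sub => /= hx.
    by apply: (h x); split => //; exact: hx.
  by rewrite N0 lebesgue_measure_itv/= lte_fin ltr01 -EFinD subr0 lee_fin
    lt_geF.
exists (w x0); apply: ae_weaken wae => x hx x01'.
rewrite -(hx x01') -wx0.
exact: (@weak_deriv0_derive w (fun z => itvint 0 z w) x x0 w1 w0).
Qed.

End DuBoisReymond.

(** * The space H^1(0, 1) *)

Section SobolevOneD.
Context {R : realType}.
Implicit Types (a b c d h s t x y k K : R) (f g p q w phi : R -> R).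
Local Notation mu := (@lebesgue_measure R).

Lemma L1on_test g phi : L2on 0 1 g -> test_function phi ->
  L1on 0 1 (fun x => g x * phi x).
Proof.
move=> g2 tphi; apply: L2onM => //; apply: L2on_continuous.
by apply: continuous_subspaceT; exact: test_continuous.
Qed.

Lemma L1on_dtest g phi : L2on 0 1 g -> test_function phi ->
  L1on 0 1 (fun x => g x * derive1 phi x).
Proof.
move=> g2 [_ cphi _]; apply: L2onM => //; apply: L2on_continuous.
exact: continuous_subspaceT.
Qed.

Lemma weak_derivB q g q' g' : L2on 0 1 q -> L2on 0 1 g -> L2on 0 1 q' ->
  L2on 0 1 g' -> is_weak_deriv q g -> is_weak_deriv q' g' ->
  is_weak_deriv (q \- q') (g \- g').
Proof.
move=> q2 g2 q2' g2' qg qg' phi tphi; rewrite !dotL2E.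
have E f f' (psi : R -> R) : L1on 0 1 (fun x => f x * psi x) ->
    L1on 0 1 (fun x => f' x * psi x) ->
    itvint 0 1 (fun x => (f \- f') x * psi x) =
    itvint 0 1 (fun x => f x * psi x) - itvint 0 1 (fun x => f' x * psi x).
  move=> f1 f1'; rewrite -itvintB//; apply: eq_itvint => x _.
  by rewrite /= mulrBl.
rewrite !E; [|exact: L1on_test|exact: L1on_test|exact: L1on_dtest..].
have := qg phi tphi; have := qg' phi tphi; rewrite !dotL2E => -> ->.
by rewrite opprB opprK addrC.
Qed.

Lemma weak_deriv0_of q q' g : L2on 0 1 q -> L2on 0 1 q' ->
  is_weak_deriv q g -> is_weak_deriv q' g -> weak_deriv0 (q \- q').
Proof.
move=> q2 q2' qg qg' phi tphi.
have := qg phi tphi; have := qg' phi tphi; rewrite !dotL2E => e e'.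
have : itvint 0 1 (fun x => q x * derive1 phi x - q' x * derive1 phi x) = 0.
  by rewrite itvintB ?e ?e' ?subrr//; exact: L1on_dtest.
by apply: etrans; apply: eq_itvint => x _; rewrite /= mulrBl.
Qed.

(** The difference of q and of the integral of g is continuous and has
    vanishing weak derivative, hence is constant. *)
Lemma weak_deriv_primitive q g : {within `[0, 1], continuous q} ->
  L2on 0 1 g -> is_weak_deriv q g -> primitive 0 1 q g.
Proof.
move=> qc g2 qg; have Gg := primitive_itvint g2.
have Gc := primitive_continuous ler01 Gg.
have := weak_deriv0_of (L2on_continuous qc) (L2on_continuous Gc) qg
  (primitive_weak_deriv Gg).
move=> /weak_deriv0_continuous h.
have {}h x : 0 <= x <= 1 -> q x - itvint 0 x g = q 0 - itvint 0 0 g.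
  apply: h => z; apply: cvgB; [exact: qc|exact: Gc].
split=> // x y x0 xy y1.
have := h x; have := h y; rewrite x0 y1 (le_trans x0 xy) (le_trans xy y1).
move=> /(_ isT) hy /(_ isT) hx; case: Gg => _ /(_ x y x0 xy y1) <-; lra.
Qed.

(** Without continuity the same argument gives the conclusion only almost
    everywhere. *)
Lemma weak_deriv_ae_rep q g : L2on 0 1 q -> L2on 0 1 g -> is_weak_deriv q g ->
  exists k, {ae mu, forall x, 0 < x < 1 -> q x = k + itvint 0 x g}.
Proof.
move=> q2 g2 qg; have Gg := primitive_itvint g2.
have Gc := primitive_continuous ler01 Gg.
have := weak_deriv0_of q2 (L2on_continuous Gc) qg (primitive_weak_deriv Gg).
move=> /weak_deriv0_ae [|k hk]; first exact/L2on_L1/L2onB/(L2on_continuous Gc).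
exists k; apply: ae_weaken hk => x /= h x01; have := h x01; lra.
Qed.

(** The integral of g - g' has vanishing weak derivative, hence is constant, and
    its derivative is g - g' almost everywhere. *)
Lemma weak_deriv_ae_unique q g g' : L2on 0 1 g -> L2on 0 1 g' ->
  is_weak_deriv q g -> is_weak_deriv q g' ->
  {ae mu, forall x, 0 < x < 1 -> g x = g' x}.
Proof.
move=> g2 g2' qg qg'; have r2 := L2onB g2 g2'.
have Gg := primitive_itvint r2; have Gc := primitive_continuous ler01 Gg.
have : weak_deriv0 (itvint 0 ^~ (fun x => g x - g' x)).
  move=> phi tphi; have := primitive_weak_deriv Gg tphi; rewrite !dotL2E => ->.
  rewrite (_ : itvint _ _ _ = itvint 0 1 (fun x => g x * phi x - g' x * phi
    x)); last first.
    by apply: eq_itvint => x _; rewrite mulrBl.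
  rewrite itvintB; [|exact: L1on_test..].
  have := qg phi tphi; have := qg' phi tphi; rewrite !dotL2E; lra.
move=> /(weak_deriv0_continuous Gc) h.
apply: ae_weaken (ftc_ae (L2on_L1 r2)) => x /= hx x01; apply/eqP.
rewrite -subr_eq0 -hx// derive1E; apply/eqP.
rewrite -[RHS](derive_cst (0 : R) x 1).
apply: near_eq_derive.
case/andP: x01 => x0 x1; near=> z.
rewrite h ?itvintxx//; apply/andP; split; apply/ltW; near: z.
  exact: lt_nbhsr.
exact: lt_nbhsl.
Unshelve. all: by end_near. Qed.

Lemma wderivP q : H1 q -> L2on 0 1 (wderiv q) /\ is_weak_deriv q (wderiv q).
Proof.
move=> [_ [g gP]]; have [/L2P h h'] : [set g | L2 g /\ is_weak_deriv q g]
  (wderiv q).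
  by apply: xgetPex; exists g.
by [].
Qed.

Lemma wderiv_primitive q : {within `[0, 1], continuous q} -> H1 q ->
  primitive 0 1 q (wderiv q).
Proof. by move=> qc /wderivP[]; exact: weak_deriv_primitive. Qed.

Lemma primitive_wderiv q g : primitive 0 1 q g -> primitive 0 1 q (wderiv q).
Proof.
move=> qg; apply: wderiv_primitive;
  first exact: (primitive_continuous ler01 qg).
exact: primitive_H1 qg.
Qed.

End SobolevOneD.

(** * Gluing over the cells of a mesh *)

Section MeshPrimitives.
Context {R : realType}.
Implicit Types (a b c d h s t x y K : R) (f g p q psi : R -> R) (M : mesh R).
Local Notation mu := (@lebesgue_measure R).

Lemma vtx_itv M k : (k < ncell M)%N ->
  [/\ 0 <= vtx M k, vtx M k < vtx M k.+1 & vtx M k.+1 <= 1].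
Proof.
move=> kn; split; last by rewrite -(vtxn M) vtx_mono// kn leqnn.
  by rewrite -(vtx0 M) vtx_mono// (ltnW kn).
exact: vtx_lt.
Qed.

Lemma L1on_mesh M f : (forall k, (k < ncell M)%N ->
  L1on (vtx M k) (vtx M k.+1) f) -> L1on 0 1 f.
Proof.
move=> fk; suff H m : (m <= ncell M)%N -> L1on (vtx M 0) (vtx M m) f.
  by have := H _ (leqnn _); rewrite vtx0 vtxn.
elim: m => [_|m IH mn].
  rewrite /L1on set_itv_ge ?bnd_simp ?ltxx//; exact: integrable_set0.
have [h0 hm _] := vtx_itv mn.
apply: L1on_cat (IH (ltnW mn)) (fk _ mn); last exact: ltW.
by rewrite vtx0.
Qed.

Lemma itvint_mesh M f : L1on 0 1 f ->
  itvint 0 1 f = \sum_(k < ncell M) itvint (vtx M k) (vtx M k.+1) f.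
Proof.
move=> f1.
suff H m : (m <= ncell M)%N ->
    itvint 0 (vtx M m) f = \sum_(k < m) itvint (vtx M k) (vtx M k.+1) f.
  by rewrite -H// vtxn.
elim: m => [_|m IH mn]; first by rewrite big_ord0 vtx0 itvintxx.
have [h0 hm h1] := vtx_itv mn.
rewrite big_ord_recr/= -IH 1?ltnW//; apply: itvint_cat => //; first exact: ltW.
exact: L1on_sub f1.
Qed.

Lemma L2on_mesh M f : (forall k, (k < ncell M)%N ->
  L2on (vtx M k) (vtx M k.+1) f) -> L2on 0 1 f.
Proof.
move=> fk; split; last by apply: (@L1on_mesh M) => k /fk[].
by apply: L1on_measurable; apply: (@L1on_mesh M) => k /fk/L2on_L1.
Qed.

Lemma primitive_mesh M q g : (forall k, (k < ncell M)%N ->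
  primitive (vtx M k) (vtx M k.+1) q g) -> primitive 0 1 q g.
Proof.
move=> qg.
suff H m : (m < ncell M)%N -> primitive 0 (vtx M m.+1) q g.
  by have := H (ncell M).-1; rewrite prednK ?ncell_gt0// vtxn; exact.
elim: m => [n0|m IH mn]; first by have := qg _ n0; rewrite vtx0.
have [h0 hm h1] := vtx_itv mn.
by apply: primitive_cat (IH (ltnW mn)) (qg _ mn) => //; exact: ltW.
Qed.

Definition cellwise M (F : nat -> R -> R) x : R :=
  \sum_(k < ncell M) (vtx M k < x < vtx M k.+1)%R%:R * F k x.

Lemma cellwiseE M (F : nat -> R -> R) k x : (k < ncell M)%N ->
  vtx M k < x < vtx M k.+1 -> cellwise M F x = F k x.
Proof.
move=> kn kx; rewrite /cellwise (bigD1 (Ordinal kn))//= kx mul1r big1 ?addr0//.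
move=> [j jn] /=; rewrite -val_eqE/= => jk.
case/andP: kx => kx xk; have [jk'|kj|jk'] := ssrnat.ltngtP j k.
- have h : vtx M j.+1 <= vtx M k by rewrite vtx_mono// jk' ltnW.
  by rewrite [x < _]ltNge (ltW (le_lt_trans h kx)) andbF mul0r.
- have h : vtx M k.+1 <= vtx M j by rewrite vtx_mono// kj ltnW.
  by rewrite ltNge (ltW (lt_le_trans xk h)) mul0r.
- by rewrite jk' eqxx in jk.
Qed.

(** On a cell only the shape functions of its two ends are nonzero; by the
    compatibility condition the left one is 1 minus the right one. At a vertex
    the branches of the definition of the shapes agree, since psi 0 = 0 and
    psi 1 = 1. *)
Lemma shape_sum psi M (c : nat -> R) k x : psi 0 = 0 ->
  (forall t, t \in `[0, 1] -> psi t + psi (1 - t) = 1) -> (k < ncell M)%N ->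
  vtx M k <= x <= vtx M k.+1 ->
  \sum_(j < (ncell M).+1) c j * Defs.shape psi M j x =
  c k + (c k.+1 - c k) * psi ((x - vtx M k) / hcell M k).
Proof.
move=> psi0 psiC kn /[dup] kx /andP[kx' xk].
have psi1 : psi 1 = 1.
  by have := psiC 0; rewrite psi0 subr0 add0r; apply;
    rewrite in_itv/= lexx ler01.
have [h0 hlt h1] := vtx_itv kn; have hk := hcell_gt0 kn.
have shapeL : Defs.shape psi M k x = 1 - psi ((x - vtx M k) / hcell M k).
  have s01 : (x - vtx M k) / hcell M k \in `[0, 1].
    rewrite in_itv/=; apply/andP; split.
      by apply: divr_ge0; [rewrite subr_ge0|exact: ltW].
    by rewrite ler_pdivrMr// mul1r /hcell lerD2r.
  rewrite /Defs.shape kn kx/=; case: ifPn => [/andP[k0 /andP[_ xk']]|_].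
    have -> : x = vtx M k by apply/eqP; rewrite eq_le xk'.
    rewrite subrr mul0r psi0 subr0.
    rewrite /hcell prednK// divff// subr_eq0 gt_eqF// vtx_smono//.
    by rewrite prednK// leqnn ltnW.
  rewrite -(psiC _ s01) addrAC subrr add0r; congr psi.
  by rewrite /hcell; field; rewrite subr_eq0 gt_eqF.
have shapeR : Defs.shape psi M k.+1 x = psi ((x - vtx M k) / hcell M k).
  by rewrite /Defs.shape /= kx.
have shapeO j : (j <= ncell M)%N -> j != k -> j != k.+1 ->
  Defs.shape psi M j x = 0.
  move=> jn jk jk1; have [jltk|kltj|/eqP] := ssrnat.ltngtP j k;
    last by rewrite (negbTE jk).
    have hjk : vtx M j < vtx M k by rewrite vtx_smono// jltk ltnW.
    have hjk1 : vtx M j.+1 <= vtx M k by rewrite vtx_mono// jltk ltnW.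
    rewrite /Defs.shape [x <= vtx M j]leNgt (lt_le_trans hjk kx')/= !andbF.
    case: ifPn => // /andP[_ /andP[_ xj]].
    have -> : x = vtx M j.+1 by apply/eqP; rewrite eq_le xj (le_trans hjk1).
    by rewrite subrr mul0r.
  case: j jn jk jk1 kltj => // j jn _;
    rewrite eqSS ltnS leq_eqVlt eq_sym => /negbTE -> /= kj.
  have hkj : vtx M k.+1 <= vtx M j by rewrite vtx_mono// kj ltnW.
  have hkj1 : vtx M k.+1 < vtx M j.+1 by rewrite vtx_smono// ltnS kj.
  rewrite /Defs.shape [vtx M j.+1 <= x]leNgt (le_lt_trans xk hkj1)/= andbF.
  case: ifPn => // /andP[jx _].
  have -> : x = vtx M j by apply/eqP; rewrite eq_le jx (le_trans xk).
  by rewrite subrr mul0r.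
have kn1 : (k < (ncell M).+1)%N by rewrite ltnW.
rewrite (bigD1 (Ordinal kn1))//= (bigD1 (Ordinal (kn : (k.+1 < (ncell
  M).+1)%N)))//=; last first.
  by rewrite -val_eqE/= gtn_eqF.
rewrite big1 ?addr0 ?shapeL ?shapeR; first by ring.
move=> [j jn] /=; rewrite -!val_eqE/= => /andP[jk jk1].
by rewrite shapeO ?mulr0.
Qed.

End MeshPrimitives.

(** * Expansions in the shape functions *)

Section DiscreteEquivalence.
Context {R : realType}.
Implicit Types (a b s t x y : R) (f g p q v psi : R -> R) (M : mesh R).
Implicit Types (c u w : nat -> R).
Local Notation mu := (@lebesgue_measure R).

(** Satisfied by the generator psi of the test fluxes and by the identity, which
    generates the hat functions: both families are treated together. *)
Definition compatible psi : Prop :=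
  psi 0 = 0 /\ forall t, t \in `[0, 1] -> psi t + psi (1 - t) = 1.

Lemma compatible1 psi : compatible psi -> psi 1 = 1.
Proof.
by move=> [psi0 psiC]; have := psiC 0; rewrite psi0 subr0 add0r; apply;
  rewrite in_itv/= lexx ler01.
Qed.

Lemma compatible_id : compatible id.
Proof. by split=> // t _; rewrite addrC subrK. Qed.

Lemma admissible_compatible psi : admissible_shape psi -> compatible psi.
Proof. by case. Qed.

Definition expansion psi M c x : R :=
  \sum_(j < (ncell M).+1) c j * Defs.shape psi M j x.

Lemma expansion_cell psi M c k x : compatible psi -> (k < ncell M)%N ->
  vtx M k <= x <= vtx M k.+1 ->
  expansion psi M c x = c k + (c k.+1 - c k) * psi ((x - vtx M k) / hcell M k).
Proof. by move=> [psi0 psiC]; exact: shape_sum. Qed.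

Lemma expansion_vtx psi M c k : compatible psi -> (k <= ncell M)%N ->
  expansion psi M c (vtx M k) = c k.
Proof.
move=> cpsi; case: k => [_|k kn].
  have n0 := ncell_gt0 M; have [_ hlt _] := vtx_itv n0.
  rewrite (expansion_cell _ cpsi n0) ?lexx ?ltW//.
  by case: cpsi => psi0 _; rewrite subrr mul0r psi0 mulr0 addr0.
have [_ hlt _] := vtx_itv kn.
rewrite (expansion_cell _ cpsi kn) ?lexx ?ltW//.
rewrite divff ?gt_eqF ?hcell_gt0//.
by rewrite compatible1// mulr1 addrC subrK.
Qed.

Definition expansion_deriv g M c : R -> R := cellwise M (fun k x =>
  (c k.+1 - c k) * ((hcell M k)^-1 * g ((x - vtx M k) / hcell M k))).

(** On each cell an expansion is an affine function of a rescaled copy of psi;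
    the pieces are glued at the vertices, where the primitives agree. *)
Lemma expansion_primitive psi g M c : compatible psi -> primitive 0 1 psi g ->
  primitive 0 1 (expansion psi M c) (expansion_deriv g M c).
Proof.
move=> cpsi psig; apply: (@primitive_mesh _ M) => k kn.
have [_ hlt _] := vtx_itv kn.
have := primitiveZ (c k.+1 - c k) (primitive_affine hlt psig).
move=> /(primitiveD (primitive_cst _ _ (c k))).
apply: eq_primitive => x xk; first by rewrite (expansion_cell _ cpsi kn).
by rewrite [RHS](cellwiseE _ kn xk) add0r.
Qed.

Lemma QTP psi M q : QT psi M q <->
  exists c, forall x, 0 <= x <= 1 -> q x = expansion psi M c x.
Proof.
split=> -[c qc]; exists c => x; first by move=> x01; apply: qc; rewrite in_itv.
by rewrite in_itv/=; exact: qc.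
Qed.

Definition midcell M k : R := (vtx M k + vtx M k.+1) / 2.

Lemma midcell_in M k : (k < ncell M)%N -> vtx M k < midcell M k < vtx M k.+1.
Proof. by move=> kn; have [_ h _] := vtx_itv kn; rewrite /midcell; lra. Qed.

Lemma UT_cell M v k x : UT M v -> (k < ncell M)%N ->
  vtx M k < x < vtx M k.+1 -> v x = v (midcell M k).
Proof.
move=> vT kn xk; have [c vc] := vT k kn.
by rewrite !vc// in_itv//=; exact: midcell_in.
Qed.

Lemma cell_sub M k x : (k < ncell M)%N ->
  vtx M k < x < vtx M k.+1 -> 0 <= x <= 1.
Proof.
move=> kn /andP[xk xk1]; have [h0 _ h1] := vtx_itv kn.
by rewrite (le_trans h0 (ltW xk)) (le_trans (ltW xk1) h1).
Qed.

(** Integrated against a function constant on cells, a derivative contributes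
    only its increments over the cells; any representative of it will do. *)
Lemma itvint_step_primitive M v q g w : primitive 0 1 q g ->
  (forall k x, (k < ncell M)%N -> vtx M k < x < vtx M k.+1 -> v x = w k) ->
  L1on 0 1 (fun x => v x * g x) /\
  itvint 0 1 (fun x => v x * g x) =
  \sum_(k < ncell M) w k * (q (vtx M k.+1) - q (vtx M k)).
Proof.
move=> [g2 qg] vw; have g1 := L2on_L1 g2.
have vg1 : L1on 0 1 (fun x => v x * g x).
  apply: (@L1on_mesh _ M) => k kn; have [h0 hlt h1] := vtx_itv kn.
  apply: (@eq_L1on _ _ _ (fun x => w k * g x)) => [x xk|];
    first by rewrite (vw k).
  by apply: L1onZ; exact: L1on_sub g1.
split => //; rewrite (itvint_mesh M vg1); apply: eq_bigr => -[k kn] _ /=.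
have [h0 hlt h1] := vtx_itv kn.
rewrite (@eq_itvint _ _ _ _ (fun x => w k * g x)); last first.
  by move=> x xk; rewrite (vw k).
by rewrite itvintZ ?qg// ?ltW//; exact: L1on_sub g1.
Qed.

(** By compatibility psi and its reflection have sum 1, and they have the same
    integral. *)
Lemma itvint_half psi : {within `[0, 1], continuous psi} -> compatible psi ->
  itvint 0 1 psi = 2^-1.
Proof.
move=> psic [_ psiC]; have psi1 := L1on_continuous psic.
have psiE t : 0 < t < 1 -> psi (1 - t) = 1 - psi t.
  by move=> /andP[t0 t1]; have := psiC t; rewrite in_itv/= !ltW// => /(_ isT);
    lra.
have psi1' : L1on 0 1 (fun t => psi (1 - t)).
  apply: (@eq_L1on _ _ _ (fun t => 1 - psi t)); first by move=> t /psiE.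
  by apply: L1onB => //; exact: L1on_cst.
have sym : itvint 0 1 (fun t => psi (1 - t)) = itvint 0 1 psi.
  have h01 : 0 <= (1 : R) <= 1 by rewrite ler01 lexx.
  have := Rintegration_by_substitution_onem h01 psic.
  rewrite unstable.onem1 => e; rewrite -itvint_cc; last exact: L1on_measurable.
  by rewrite -[RHS]itvint_cc; [exact/esym|exact: L1on_measurable].
have : itvint 0 1 (fun t => psi t + psi (1 - t)) = 1.
  rewrite (@eq_itvint _ _ _ _ (fun=> 1)) ?itvint_cst ?subr0 ?mulr1//.
  by move=> t /psiE ->; rewrite addrC subrK.
by rewrite itvintD// sym; lra.
Qed.

(** By [itvint_half], the orthogonality condition says that the integral of
    s psi, like that of psi, is 1/2. The pairing of the two affine shapes with
    the two psi shapes is then half the identity: the mass matrix is lumped. *)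
Lemma itvint_reference psi (P0 P1 c0 c1 : R) : admissible_shape psi ->
  itvint 0 1 (fun s => (P0 + (P1 - P0) * s) * (c0 + (c1 - c0) * psi s)) =
  2^-1 * (P0 * c0 + P1 * c1).
Proof.
move=> adm; have cpsi := admissible_compatible adm.
case: adm => psic _ _ _ orth.
have psi1 := L1on_continuous psic; have half := itvint_half psic cpsi.
have idc : {within `[(0:R), 1], continuous (fun s : R => s)}.
  by apply: continuous_subspaceT => s; exact: cvg_id.
have id2 := L2on_continuous idc; have id1 := L2on_L1 id2.
have spsi1 : L1on 0 1 (fun s => s * psi s) := L2onM id2 (L2on_continuous psic).
have half' : itvint 0 1 (fun s => s * psi s) = 2^-1.
  have : itvint 0 1 (fun s => psi s - s * psi s) = 0.
    apply: etrans orth; rewrite itvint_cc; first by apply: eq_itvint => s _;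
      ring.
    apply: (@eq_measurable_itv _ _ _ (fun s => psi s - s * psi s)).
      by move=> s _; ring.
    by apply: L1on_measurable; exact: L1onB.
  by rewrite itvintB// half; lra.
have halfid : itvint 0 1 (fun s : R => s) = 2^-1.
  exact: (itvint_half idc compatible_id).
rewrite (@eq_itvint _ _ _ _ (fun s => (P0 * c0 + (P1 - P0) * c0 * s) +
  (P0 * (c1 - c0) * psi s + (P1 - P0) * (c1 - c0) * (s * psi s)))); last first.
  by move=> s _; ring.
have i1 : L1on 0 1 (fun s => (P1 - P0) * c0 * s) := L1onZ _ id1.
have i2 : L1on 0 1 (fun s => P0 * (c1 - c0) * psi s) := L1onZ _ psi1.
have i3 : L1on 0 1 (fun s => (P1 - P0) * (c1 - c0) * (s * psi s)) :=
  L1onZ _ spsi1.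
have i0 := L1on_cst 0 1 (P0 * c0).
rewrite (itvintD (L1onD i0 i1) (L1onD i2 i3)) (itvintD i0 i1) (itvintD i2 i3).
rewrite itvint_cst// (itvintZ _ id1) (itvintZ _ psi1) (itvintZ _ spsi1) half
  half' halfid subr0; by field.
Qed.

Lemma itvint_expansion psi M w c : admissible_shape psi ->
  itvint 0 1 (fun x => expansion id M w x * expansion psi M c x) =
  \sum_(k < ncell M) 2^-1 * hcell M k * (w k * c k + w k.+1 * c k.+1).
Proof.
move=> adm; have cpsi := admissible_compatible adm.
have [psic psiH1 _ _ _] := adm.
have EG := expansion_primitive M c cpsi (wderiv_primitive psic psiH1).
have EG' := expansion_primitive M w compatible_id (primitive_id 0 1).
have EE := L2onM (L2on_continuous (primitive_continuous ler01 EG'))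
  (L2on_continuous (primitive_continuous ler01 EG)).
rewrite (itvint_mesh M EE); apply: eq_bigr => -[k kn] _ /=.
have [h0 hlt h1] := vtx_itv kn; have hk := hcell_gt0 kn.
have idc : {within `[(0:R), 1], continuous (fun s : R => s)}.
  by apply: continuous_subspaceT => s; exact: cvg_id.
have L1ref : L1on 0 1 (fun s => (w k + (w k.+1 - w k) * s) *
    (c k + (c k.+1 - c k) * psi s)).
  apply: L2onM; (apply: L2onD; first exact: L2on_cst); apply: L2onZ;
    exact: L2on_continuous.
have := itvint_affine (vtx M k) hk L1ref.
rewrite itvint_reference// mulr0 addr0 mulr1 {2}/hcell addrCA subrr addr0.
rewrite mulrA [_ / 2]mulrC => <-; apply: eq_itvint => x /andP[kx xk].
have kxk : vtx M k <= x <= vtx M k.+1 by rewrite !ltW.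
by rewrite (expansion_cell _ cpsi kn kxk) (expansion_cell _ compatible_id kn
  kxk).
Qed.

(** The dual length of a vertex collects half of each adjacent cell. *)
Lemma hdual_sum M w :
  \sum_(k < ncell M) 2^-1 * hcell M k * (w k + w k.+1) =
  \sum_(j < (ncell M).+1) hdual M j * w j.
Proof.
pose a k := 2^-1 * hcell M k; have n0 := ncell_gt0 M.
have hE j : (j <= ncell M)%N -> hdual M j =
    (if (j < ncell M)%N then a j else 0) + (if (0 < j)%N then a j.-1 else 0).
  move=> jn; rewrite /hdual; case: eqP => [->|/eqP j0].
    by rewrite ltnn n0 addr0.
  rewrite lt0n j0; case: eqP => [->|/eqP jn']; first by rewrite ltnn add0r.
  by rewrite ltn_neqAle jn' jn /a mulrDr addrC.
transitivity (\sum_(j < (ncell M).+1)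
   ((if (j < ncell M)%N then a j else 0) * w j + (if (0 < j)%N then a j.-1 else
     0) * w j)).
  rewrite big_split/= big_ord_recr/= ltnn mul0r addr0.
  rewrite [X in _ = _ + X]big_ord_recl/= mul0r add0r -big_split/=.
  by apply: eq_bigr => -[k kn] _ /=; rewrite kn /bump/= -/(a k) mulrDr.
by apply: eq_bigr => -[j jn] _ /=; rewrite hE// mulrDl.
Qed.

Lemma sum_by_parts n (u c : nat -> R) :
  \sum_(k < n) u k.+1 * (c k.+1 - c k) =
  u n.+1 * c n - u 0%N * c 0%N - \sum_(j < n.+1) (u j.+1 - u j) * c j.
Proof.
elim: n => [|n IH]; first by rewrite big_ord0 big_ord_recr big_ord0/=; ring.
by rewrite big_ord_recr/= IH [in RHS]big_ord_recr/=; ring.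
Qed.

End DiscreteEquivalence.

(** * Equivalence of the two methods *)

Section PartOne.
Context {R : realType}.
Implicit Types (a b s t x y : R) (f g p q v psi uT pT : R -> R) (M : mesh R).
Implicit Types (c u w uh ph : nat -> R).
Local Notation mu := (@lebesgue_measure R).

Lemma hdual_gt0 M j : (j <= ncell M)%N -> 0 < hdual M j.
Proof.
move=> jn; rewrite /hdual; have n0 := ncell_gt0 M.
case: eqP => [_|/eqP j0]; first by rewrite mulr_gt0 ?hcell_gt0// invr_gt0.
case: eqP => [_|/eqP jn']; first
  by rewrite mulr_gt0 ?hcell_gt0 ?invr_gt0// prednK.
rewrite mulr_gt0 ?invr_gt0// addr_gt0 ?hcell_gt0//.
  by rewrite prednK ?lt0n.
by rewrite ltn_neqAle jn'.
Qed.

Lemma sum_hcell M : \sum_(k < ncell M) hcell M k = 1.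
Proof.
rewrite -(big_mkord xpredT (hcell M)) telescope_sumr ?vtxn ?vtx0 ?subr0//.
Qed.

Lemma sum_hdual M : \sum_(j < (ncell M).+1) hdual M j = 1.
Proof.
under eq_bigr do rewrite -[hdual M _]mulr1.
rewrite -(hdual_sum M (fun=> 1)) -[RHS](sum_hcell M).
by apply: eq_bigr => k _; field.
Qed.

Definition cellint M f k : R := itvint (vtx M k) (vtx M k.+1) f.

Lemma fv_schemeP M f uh ph : L2on 0 1 f -> fv_scheme M f uh ph <->
  [/\ uh 0%N = 0, uh (ncell M).+1 = 0,
      forall j, (j <= ncell M)%N -> hdual M j * ph j = uh j.+1 - uh j &
      forall j, (j < ncell M)%N -> ph j.+1 - ph j = - cellint M f j].
Proof.
move=> f2.
have ccE j : (j < ncell M)%N ->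
    \int[mu]_(x in `[vtx M j, vtx M j.+1]) f x = cellint M f j.
  move=> jn; have [h0 hlt h1] := vtx_itv jn.
  by rewrite itvint_cc//; apply: L1on_measurable; apply: L1on_sub (L2on_L1 f2).
split=> -[u0 un pE fE]; split=> // j jn.
- by rewrite pE// mulrA divff ?mul1r// gt_eqF// hdual_gt0.
- have := fE j jn; rewrite ccE// -mulrDr => /eqP.
  rewrite mulf_eq0 invr_eq0 gt_eqF ?hcell_gt0//= addr_eq0.
  by move=> /eqP.
- by rewrite -pE// mulrA mulVf ?mul1r// gt_eqF// hdual_gt0.
- by rewrite ccE// fE// -mulrDr addNr mulr0.
Qed.

(** The balance equations determine the fluxes up to a constant, which is fixed
    by the vanishing of the sum of the increments of u, that is, of the sum of
    the hdual M i * p_i; recall that the dual lengths have sum 1. *)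
Definition fv_flux M f j : R :=
  \sum_(i < (ncell M).+1) hdual M i * \sum_(k < i) cellint M f k -
  \sum_(k < j) cellint M f k.

Definition fv_value M f j : R := \sum_(i < j) hdual M i * fv_flux M f i.

Lemma fv_exists M f : L2on 0 1 f -> fv_scheme M f (fv_value M f) (fv_flux M f).
Proof.
move=> f2; apply/fv_schemeP => //; split=> [||j jn|j jn].
- by rewrite /fv_value big_ord0.
- rewrite /fv_value /fv_flux.
  under eq_bigr do rewrite mulrBr.
  by rewrite sumrB -mulr_suml sum_hdual mul1r subrr.
- by rewrite /fv_value big_ord_recr/= addrAC subrr add0r.
- by rewrite /fv_flux [X in _ - X - _]big_ord_recr/=; ring.
Qed.

Lemma fv_explicit M f uh ph : L2on 0 1 f -> fv_scheme M f uh ph ->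
  (forall j, (j <= (ncell M).+1)%N -> uh j = fv_value M f j) /\
  (forall j, (j <= ncell M)%N -> ph j = fv_flux M f j).
Proof.
move=> f2 /(fv_schemeP _ _ _ f2)[u0 un pE fE].
have uE j : (j <= (ncell M).+1)%N -> uh j = \sum_(i < j) hdual M i * ph i.
  elim: j => [_|j IH jn]; first by rewrite big_ord0.
  by rewrite big_ord_recr/= -IH 1?ltnW// pE// addrC subrK.
have phE j : (j <= ncell M)%N -> ph j = ph 0%N - \sum_(k < j) cellint M f k.
  elim: j => [_|j IH jn]; first by rewrite big_ord0 subr0.
  rewrite big_ord_recr/= opprD addrA -IH 1?ltnW// -fE//; ring.
have ph0 : ph 0%N = \sum_(i < (ncell M).+1) hdual M i * \sum_(k < i) cellint M
  f k.
  have := uE _ (leqnn _); rewrite un.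
  rewrite (eq_bigr (fun i : 'I__ => hdual M i * ph 0%N - hdual M i * \sum_(k <
    i) cellint M f k)).
    by rewrite sumrB -mulr_suml sum_hdual mul1r => /esym/eqP;
      rewrite subr_eq0 => /eqP.
  by move=> [i ilt] _ /=; rewrite phE// mulrBr.
have phE' j : (j <= ncell M)%N -> ph j = fv_flux M f j.
  by move=> jn; rewrite phE// ph0.
split => // j jn; rewrite uE//; apply: eq_bigr => -[i ij] _ /=.
by rewrite phE'// -ltnS (leq_trans ij).
Qed.

Lemma vtx_cover M x : 0 <= x <= 1 ->
  exists2 k, (k < ncell M)%N & vtx M k <= x <= vtx M k.+1.
Proof.
move=> /andP[x0 x1]; suff H m : (m <= ncell M)%N -> x <= vtx M m -> (0 < m)%N ->
    exists2 k, (k < ncell M)%N & vtx M k <= x <= vtx M k.+1.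
  by apply: (H (ncell M)); rewrite ?vtxn// ncell_gt0.
elim: m => // m IH mn xm _; have [xm'|/ltW mx] := leP x (vtx M m); last first.
  by exists m => //; rewrite mx.
case: m IH mn xm xm' => [_ n0 xm xm'|m IH mn xm xm'].
  exists 0%N => //; rewrite xm andbT; by rewrite vtx0.
by apply: IH => //; exact: ltnW.
Qed.

Lemma PT_expansion M q x : PT M q -> 0 <= x <= 1 ->
  q x = expansion id M (fun j => q (vtx M j)) x.
Proof.
move=> [qc qaff] x01; have [k kn kx] := vtx_cover M x01.
have [h0 hlt h1] := vtx_itv kn; have hk := hcell_gt0 kn.
have [a [b ab]] := qaff k kn.
have qE y : vtx M k <= y <= vtx M k.+1 -> q y - (a * y + b) = 0.
  apply: (@continuous_cst_closure _ (fun y => q y - (a * y + b))) => //;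
    last first.
    by move=> z kz; rewrite ab ?in_itv// subrr.
  have qck : {within `[vtx M k, vtx M k.+1], continuous q}.
    by apply: continuous_subspaceW qc; apply: subset_itv; rewrite bnd_simp.
  have affc : {within `[vtx M k, vtx M k.+1], continuous (fun y => a * y + b)}.
    apply: continuous_subspaceT => z.
    by apply: cvgD; [apply: cvgM; [exact: cvg_cst|exact: cvg_id]|exact:
      cvg_cst].
  by move=> z; apply: cvgB; [exact: qck|exact: affc].
have e1 := qE _ kx.
have e2 := qE (vtx M k); rewrite lexx (ltW hlt) in e2; have {}e2 := e2 isT.
have e3 := qE (vtx M k.+1); rewrite lexx (ltW hlt) in e3; have {}e3 := e3 isT.
rewrite (expansion_cell _ compatible_id kn kx).
move/subr0_eq: e1 => ->; move/subr0_eq: e2 => ->; move/subr0_eq: e3 => ->.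
by rewrite /hcell; field; rewrite subr_eq0 gt_eqF.
Qed.

Lemma expansion_PT M w q : (forall x, 0 <= x <= 1 ->
  q x = expansion id M w x) ->
  PT M q.
Proof.
move=> qE; apply: PT_affine => k kn.
have [h0 hlt h1] := vtx_itv kn; have hk := hcell_gt0 kn.
exists ((w k.+1 - w k) / hcell M k),
  (w k - (w k.+1 - w k) / hcell M k * vtx M k).
move=> x /[dup] kx /andP[x0 x1].
rewrite qE ?(le_trans h0 x0) ?(le_trans x1 h1)//.
by rewrite (expansion_cell _ compatible_id kn kx); ring.
Qed.

Lemma expansion_congr_primitive psi M g c q : compatible psi ->
  primitive 0 1 psi g ->
  (forall x, 0 <= x <= 1 -> q x = expansion psi M c x) ->
  primitive 0 1 q (wderiv q).
Proof.
move=> cpsi psig qE; have EG := expansion_primitive M c cpsi psig.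
by apply: primitive_wderiv; apply: eq_primitive EG => // x /qE.
Qed.

(** Lumping of (p, q), and summation by parts in (u, q'), make the coefficient
    of each nodal value of q the residual of one flux equation of the finite
    volume method; the last sum gives the balance equations. *)
Lemma gammaform_sum psi M uT pT v q uh ph w c : admissible_shape psi ->
  (forall k x, (k < ncell M)%N -> vtx M k < x < vtx M k.+1 -> uT x = uh k.+1) ->
  (forall x, 0 <= x <= 1 -> pT x = expansion id M ph x) ->
  (forall k x, (k < ncell M)%N -> vtx M k < x < vtx M k.+1 -> v x = w k) ->
  (forall x, 0 <= x <= 1 -> q x = expansion psi M c x) ->
  gammaform (uT, pT) (v, q) =
  \sum_(j < (ncell M).+1) (hdual M j * ph j - (uh j.+1 - uh j)) * c j +
  (uh (ncell M).+1 * c (ncell M) - uh 0%N * c 0%N) +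
  \sum_(k < ncell M) w k * (ph k.+1 - ph k).
Proof.
move=> adm uE pE vE qE; have cpsi := admissible_compatible adm.
have [psic psiH1 _ _ _] := adm.
have qprim := expansion_congr_primitive cpsi (wderiv_primitive psic psiH1) qE.
have pprim := expansion_congr_primitive compatible_id (primitive_id 0 1) pE.
rewrite /gammaform/= !dotL2E.
rewrite (@eq_itvint _ 0 1 (fun x => pT x * q x) (fun x => expansion id M ph x *
  expansion psi M c x)); last first.
  by move=> x /andP[x0 x1]; rewrite pE ?qE// !ltW.
rewrite itvint_expansion//.
have [_ ->] := itvint_step_primitive qprim uE.
rewrite (@eq_itvint _ 0 1 (fun x => wderiv pT x * v x) (fun x => v x * wderiv
  pT x)); last first.
  by move=> x _; rewrite mulrC.
have [_ ->] := itvint_step_primitive pprim vE.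
have vtx01 k : (k <= ncell M)%N -> 0 <= vtx M k <= 1.
  by move=> kn; rewrite -(vtx0 M) -(vtxn M) !vtx_mono ?kn ?leqnn.
have qv k : (k <= ncell M)%N -> q (vtx M k) = c k.
  by move=> kn; rewrite qE ?vtx01// expansion_vtx.
have pv k : (k <= ncell M)%N -> pT (vtx M k) = ph k.
  by move=> kn; rewrite pE ?vtx01// expansion_vtx//; exact: compatible_id.
congr (_ + _); last first.
  by apply: eq_bigr => -[k kn] _ /=; rewrite !pv// ltnW.
rewrite (hdual_sum M (fun j => ph j * c j)).
have -> : \sum_(k < ncell M) uh k.+1 * (q (vtx M k.+1) - q (vtx M k)) =
    \sum_(k < ncell M) uh k.+1 * (c k.+1 - c k).
  by apply: eq_bigr => -[k kn] _ /=; rewrite !qv// ltnW.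
rewrite sum_by_parts addrCA -sumrB addrC; congr (_ + _).
by apply: eq_bigr => j _; ring.
Qed.

Lemma dotL2_step M f v w : L2on 0 1 f ->
  (forall k x, (k < ncell M)%N -> vtx M k < x < vtx M k.+1 -> v x = w k) ->
  dotL2 f v = \sum_(k < ncell M) w k * cellint M f k.
Proof.
move=> f2 vE; rewrite dotL2E.
rewrite (@eq_itvint _ 0 1 _ (fun x => v x * f x)); last by move=> x _;
  rewrite mulrC.
have fprim := primitive_itvint f2.
have [_ ->] := itvint_step_primitive fprim vE.
apply: eq_bigr => -[k kn] _ /=; have [h0 hlt h1] := vtx_itv kn.
by case: fprim => _ ->//; exact: ltW.
Qed.

Lemma fv_pg psi M f uT pT : admissible_shape psi -> L2on 0 1 f ->
  fv_solution M f uT pT -> pg_solution psi M f uT pT.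
Proof.
move=> adm f2 [uh [ph [/(fv_schemeP _ _ _ f2)[u0 un pE fE] uTE pTE]]].
have uE k x : (k < ncell M)%N -> vtx M k < x < vtx M k.+1 -> uT x = uh k.+1.
  by move=> kn kx; rewrite (uTE k)// in_itv.
have ptE x : 0 <= x <= 1 -> pT x = expansion id M ph x.
  by move=> x01; rewrite pTE// in_itv.
split.
- by move=> k kn; exists (uh k.+1) => x; rewrite in_itv/=; exact: uE.
- exact: expansion_PT ptE.
- move=> v q vT /QTP[c qE].
  have vE k x := @UT_cell _ M v k x vT.
  rewrite (gammaform_sum adm uE ptE vE qE) (dotL2_step f2 vE) u0 un !mul0r
    subrr addr0.
  rewrite big1 ?add0r; last first.
    by move=> [j jn] _ /=; rewrite pE// subrr mul0r.
  rewrite -sumrN; apply: eq_bigr => -[k kn] _ /=.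
  by rewrite fE// mulrN.
Qed.

(** Testing with one shape function gives a flux equation, testing with the
    indicator of one cell a balance equation. *)
Lemma pg_fv psi M f uT pT : admissible_shape psi -> L2on 0 1 f ->
  pg_solution psi M f uT pT -> fv_solution M f uT pT.
Proof.
move=> adm f2 [uTT pTT pg].
pose ph j := pT (vtx M j).
pose uh j := if (0 < j <= ncell M)%N then uT (midcell M j.-1) else 0.
have uE k x : (k < ncell M)%N -> vtx M k < x < vtx M k.+1 -> uT x = uh k.+1.
  by move=> kn kx; rewrite (UT_cell uTT kn kx) /uh /= kn.
have pE x : 0 <= x <= 1 -> pT x = expansion id M ph x by exact: PT_expansion.
have u0 : uh 0%N = 0 by [].
have un : uh (ncell M).+1 = 0 by rewrite /uh /= ltnn.
exists uh, ph; split.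
- apply/fv_schemeP => //; split => // j jn.
  + pose c i : R := (i == j)%:R.
    have qT : QT psi M (expansion psi M c) by apply/QTP; exists c.
    have zT : UT M (fun=> 0) by move=> k _; exists 0.
    have := pg _ _ zT qT.
    rewrite (gammaform_sum adm uE pE (w := fun=> 0) (v := fun=> 0) _ (c :=
      c))//.
    rewrite (dotL2_step (M := M) f2 (w := fun=> 0) (v := fun=> 0))//.
    have sum0 (F : nat -> R) : \sum_(k < ncell M) 0 * F k = 0.
      by apply: big1 => k _; rewrite mul0r.
    rewrite (sum0 (fun k => ph k.+1 - ph k)) sum0 u0 un !mul0r subrr !addr0
      oppr0.
    have jn' : (j < (ncell M).+1)%N by [].
    rewrite (bigD1 (Ordinal jn'))//= /c eqxx mulr1 big1 ?addr0.
      by move=> /eqP; rewrite subr_eq0 => /eqP.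
    by move=> i; rewrite -val_eqE/= => /negbTE ->; rewrite mulr0.
  + pose w k : R := (k == j)%:R.
    pose v := cellwise M (fun k _ => w k).
    have vE k x : (k < ncell M)%N -> vtx M k < x < vtx M k.+1 -> v x = w k.
      by move=> kn kx; rewrite /v (cellwiseE _ kn kx).
    have vT : UT M v.
      by move=> k kn; exists (w k) => x; rewrite in_itv/=; exact: vE.
    have qT : QT psi M (expansion psi M (fun=> 0)) by apply/QTP;
      exists (fun=> 0).
    have := pg _ _ vT qT.
    rewrite (gammaform_sum adm uE pE vE (c := fun=> 0))// (dotL2_step f2 vE).
    rewrite !mulr0 subrr addr0 big1 ?add0r; last by move=> k _; rewrite mulr0.
    rewrite (bigD1 (Ordinal jn))//= /w eqxx mul1r big1 ?addr0; last first.
      by move=> i; rewrite -val_eqE/= => /negbTE ->; rewrite mul0r.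
    rewrite (bigD1 (Ordinal jn))//= eqxx mul1r big1 ?addr0//.
    by move=> i; rewrite -val_eqE/= => /negbTE ->; rewrite mul0r.
- by move=> k kn x; rewrite in_itv/=; exact: uE.
- by move=> x; rewrite in_itv/=; exact: pE.
Qed.

End PartOne.

(** * Error estimates for continuous representatives *)

Section ErrorEstimate.
Context {R : realType}.
Implicit Types (a b s t x y : R) (f g p q v psi uT pT : R -> R) (M : mesh R).
Implicit Types (c w uh ph : nat -> R).
Local Notation mu := (@lebesgue_measure R).

Lemma eq_ae_itvint a b f g : 0 <= a -> b <= 1 -> L1on a b f -> L1on a b g ->
  {ae mu, forall x, 0 < x < 1 -> f x = g x} -> itvint a b f = itvint a b g.
Proof.
move=> a0 b1 f1 g1 fg; rewrite /itvint /Rintegral; congr fine.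
apply: ae_eq_integral => //.
- by case/integrableP: f1.
- by case/integrableP: g1.
- apply: ae_weaken fg => x fgx /=; rewrite in_itv/= => /andP[ax xb].
  by rewrite fgx// (le_lt_trans a0 ax) (lt_le_trans xb b1).
Qed.

Lemma hcell_le_hmax M k : (k < ncell M)%N -> hcell M k <= hmax M.
Proof. by move=> kn; exact: (le_bigmax _ (fun j : 'I_(ncell M) => hcell M j)
  (Ordinal kn)). Qed.

Lemma hmax_ge0 M : 0 <= hmax M.
Proof. exact: le_trans (ltW (hcell_gt0 (ncell_gt0 M))) (hcell_le_hmax
  (ncell_gt0 M)). Qed.

Definition norm01 f : R := Num.sqrt (itvint 0 1 (fun x => f x ^+ 2)).

Definition cellavg M f k : R := cellint M f k / hcell M k.

Lemma itvint_abs_le f : L2on 0 1 f -> itvint 0 1 (fun x => `|f x|) <= norm01 f.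
Proof.
move=> f2; have nf2 : L2on 0 1 (fun x => `|f x|).
  case: f2 => mf f2; split; first exact: measurableT_comp.
  by apply: eq_L1on f2 => x _; rewrite real_normK// num_real.
have := itvint_sqr_le ler01 nf2; rewrite subr0 mul1r.
rewrite (@eq_itvint _ 0 1 (fun x => `|f x| ^+ 2) (fun x => f x ^+ 2));
  last first.
  by move=> x _; rewrite real_normK// num_real.
have n0 : 0 <= itvint 0 1 (fun x => `|f x|) by exact: itvint_ge0.
move=> h; rewrite -[leLHS]ger0_norm// -sqrtr_sqr ler_wsqrtr//.
Qed.

Lemma itvint_cell_affine M w k : (k < ncell M)%N ->
  itvint (vtx M k) (vtx M k.+1) (expansion id M w) =
  2^-1 * hcell M k * (w k + w k.+1).
Proof.
move=> kn; have [h0 hlt h1] := vtx_itv kn; have hk := hcell_gt0 kn.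
have idc : {within `[(0:R), 1], continuous (fun s : R => s)}.
  by apply: continuous_subspaceT => s; exact: cvg_id.
have id1 : L1on 0 1 (fun s : R => (w k.+1 - w k) * s) :=
  L1onZ _ (L1on_continuous idc).
have L1ref := L1onD (L1on_cst 0 1 (w k)) id1.
have := itvint_affine (vtx M k) hk L1ref.
rewrite (itvintD (L1on_cst 0 1 (w k)) id1) itvint_cst//.
rewrite (itvintZ _ (L1on_continuous idc)) (itvint_half idc compatible_id).
rewrite mulr0 addr0 mulr1 {2}/hcell addrCA subrr addr0 subr0 => e.
rewrite (@eq_itvint _ _ _ _ (fun x => w k + (w k.+1 - w k) * ((x - vtx M k) /
  hcell M k))).
  by rewrite e; field.
move=> x /andP[kx xk].
by rewrite (expansion_cell _ compatible_id kn)// !ltW.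
Qed.

Lemma itvint_le_cells M (F : R -> R) K : L1on 0 1 F ->
  (forall k x, (k < ncell M)%N -> vtx M k < x < vtx M k.+1 -> F x <= K) ->
  itvint 0 1 F <= K.
Proof.
move=> F1 FK; rewrite (itvint_mesh M F1) -[leRHS]mulr1 -(sum_hcell M) mulr_sumr.
apply: ler_sum => -[k kn] _ /=; have [h0 hlt h1] := vtx_itv kn.
rewrite -(@itvint_cst _ _ _ K (ltW hlt)); apply: le_itvint;
  first exact: L1on_sub F1.
  exact: L1on_cst.
by move=> x; exact: FK.
Qed.

(** The continuous problem written with primitives: - p' = f and p = u', where
    the datum f has derivative g. *)
Section Core.
Context (M : mesh R) (f g p u : R -> R) (uh ph : nat -> R).
Context (fg : primitive 0 1 f g) (pf : primitive 0 1 p (fun x => - f x)).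
Context (up : primitive 0 1 u p) (u0 : u 0 = 0) (u1 : u 1 = 0).
Context (fv : fv_scheme M f uh ph).

Local Notation B := (norm01 g).
Local Notation A := (norm01 f).
Local Notation G := (cellint M (fun x => `|g x|)).
Local Notation avg := (cellavg M f).

Let f2 : L2on 0 1 f.
Proof. exact: L2on_continuous (primitive_continuous ler01 fg). Qed.

Let p2 : L2on 0 1 p.
Proof. exact: L2on_continuous (primitive_continuous ler01 pf). Qed.

Let g2 : L2on 0 1 g. Proof. by case: fg. Qed.

Let fvs := (fv_schemeP M uh ph f2).1 fv.

(** The mean of p is u 1 - u 0 = 0, so that p x is the mean over t of
    p x - p t, which is bounded by the integral of |f|. *)
Lemma flux_bound x : 0 <= x <= 1 -> `|p x| <= A.
Proof.
move=> /andP[x0 x1].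
have pb t : 0 <= t <= 1 -> `|p x - p t| <= A.
  suff H y z : 0 <= y -> y <= z -> z <= 1 -> `|p z - p y| <= A.
    move=> /andP[t0 t1]; have [tx|/ltW xt] := leP t x; first exact: H.
    by rewrite distrC; exact: H.
  move=> y0 yz z1; case: pf => _ ->//.
  have f1 := L2on_L1 f2; have fyz : L1on y z f by exact: L1on_sub f1.
  rewrite itvintN// normrN (le_trans (normr_itvint fyz))//.
  rewrite (le_trans _ (itvint_abs_le f2))//.
  rewrite (itvint_cat y0 (le_trans yz z1)) ?(itvint_cat yz z1)//; last 2 first.
  - by apply: L1on_norm; apply: L1on_sub f1.
  - exact: L1on_norm.
  by rewrite addrCA lerDl addr_ge0 ?itvint_ge0.
have : itvint 0 1 (fun t => p x - p t) = p x.
  rewrite itvintB; [|exact: L1on_cst|exact: L2on_L1].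
  rewrite itvint_cst// subr0 mulr1; case: up => _ /(_ 0 1) <- //.
  by rewrite u0 u1 !subr0.
move=> <-; rewrite (le_trans (normr_itvint_le (K :=
  A) ler01 _ _)) ?subr0 ?mulr1//.
  by apply: L1onB; [exact: L1on_cst|exact: L2on_L1].
by move=> t /andP[t0 t1]; rewrite pb// !ltW.
Qed.

Lemma sum_cell_variation : \sum_(k < ncell M) G k <= B.
Proof.
by rewrite -itvint_mesh; [exact: itvint_abs_le|exact/L1on_norm/L2on_L1].
Qed.

Lemma cell_variation_ge0 k : 0 <= G k. Proof. exact: itvint_ge0. Qed.

Lemma cell_variation_le k : (k < ncell M)%N -> G k <= B.
Proof.
move=> kn; apply: le_trans sum_cell_variation.
rewrite (bigD1 (Ordinal kn))//= lerDl sumr_ge0// => *;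
  exact: cell_variation_ge0.
Qed.

Lemma cell_oscillation k x : (k < ncell M)%N -> vtx M k <= x <= vtx M k.+1 ->
  `|f x - avg k| <= G k.
Proof.
move=> kn /andP[kx xk]; have [h0 hlt h1] := vtx_itv kn; have hk := hcell_gt0 kn.
have osc y z : vtx M k <= y -> y <= z -> z <= vtx M k.+1 -> `|f z - f y| <= G k.
  move=> ky yz zk; have gk : L1on (vtx M k) (vtx M k.+1) g
    by apply: L1on_sub (L2on_L1 g2).
  case: fg => _ ->//; [|exact: le_trans ky|exact: le_trans zk h1].
  have gyz : L1on y z g by exact: L1on_sub gk.
  rewrite (le_trans (normr_itvint gyz))// /cellint.
  rewrite (itvint_cat ky (le_trans yz zk)) ?(itvint_cat yz zk)//; last 2 first.
  - by apply: L1on_norm; apply: L1on_sub gk.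
  - exact: L1on_norm.
  by rewrite addrCA lerDl addr_ge0 ?itvint_ge0.
have fk : L1on (vtx M k) (vtx M k.+1) f by apply: L1on_sub (L2on_L1 f2).
have E : itvint (vtx M k) (vtx M k.+1) (fun t => f x - f t) = hcell M k * (f x
  - avg k).
  rewrite itvintB; [|exact: L1on_cst|by []].
  rewrite itvint_cst ?ltW// -/(cellint M f k) -/(hcell M k) /cellavg.
  by field; rewrite gt_eqF.
have : `|hcell M k * (f x - avg k)| <= G k * hcell M k.
  rewrite -E; apply: normr_itvint_le; first exact: ltW.
    by apply: L1onB; [exact: L1on_cst|].
  move=> t /andP[kt tk]; have [tx|/ltW xt] := leP t x.
    by apply: osc => //; exact: ltW.
  by rewrite distrC; apply: osc => //; exact: ltW.
by rewrite normrM gtr0_norm// mulrC ler_pM2r.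
Qed.

(** p and the discrete flux have the same increment over each cell. *)
Lemma flux_nodal_error : exists e, forall k, (k <= ncell M)%N ->
  p (vtx M k) - ph k = e.
Proof.
exists (p (vtx M 0) - ph 0%N); elim=> // k IH kn; rewrite -IH 1?ltnW//.
have [h0 hlt h1] := vtx_itv kn; case: fvs => _ _ _ /(_ k kn).
have : p (vtx M k.+1) - p (vtx M k) = - cellint M f k.
  case: pf => _ ->//; last exact: ltW.
  by rewrite itvintN//; apply: L1on_sub (L2on_L1 f2).
lra.
Qed.

(** The interpolation error vanishes at the vertices and its derivative is the
    opposite of f minus its average over the cell. *)
Lemma interpolation_error x : 0 <= x <= 1 ->
  `|p x - expansion id M (fun j => p (vtx M j)) x| <= hmax M * B.
Proof.
move=> x01; have [k kn /[dup] kx /andP[kx' xk]] := vtx_cover M x01.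
have [h0 hlt h1] := vtx_itv kn; have hk := hcell_gt0 kn.
have fk : L1on (vtx M k) (vtx M k.+1) f by apply: L1on_sub (L2on_L1 f2).
have fx : L1on (vtx M k) x f by apply: L1on_sub fk.
have pk : p (vtx M k.+1) - p (vtx M k) = - cellint M f k.
  by case: pf => _ ->//; [rewrite itvintN|exact: ltW].
have px : p x - p (vtx M k) = - itvint (vtx M k) x f.
  by case: pf => _ ->//; [rewrite itvintN|exact: le_trans xk h1].
have -> : p x - expansion id M (fun j => p (vtx M j)) x =
    - itvint (vtx M k) x (fun t => f t - avg k).
  rewrite (expansion_cell _ compatible_id kn kx) pk.
  rewrite itvintB; [|by []|exact: L1on_cst].
  by rewrite itvint_cst// /cellavg -(opprK (itvint _ _ _)) -px; field;
    rewrite gt_eqF.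
rewrite normrN (le_trans (normr_itvint_le (K := G k) _ _ _))//.
- by apply: L1onB => //; exact: L1on_cst.
- move=> t /andP[kt tx]; apply: cell_oscillation => //.
  by rewrite (ltW kt) (le_trans (ltW tx)).
rewrite mulrC ler_pM ?subr_ge0 ?cell_variation_ge0 ?cell_variation_le//.
by rewrite (le_trans _ (hcell_le_hmax kn))// /hcell lerD2r.
Qed.

Local Notation pT := (expansion id M ph).

Lemma expansion_id_L2 w : L2on 0 1 (expansion id M w).
Proof.
have := expansion_primitive M w compatible_id (primitive_id 0 1).
by move=> /(primitive_continuous ler01)/L2on_continuous.
Qed.

(** The error is the interpolation error d of p plus the nodal error e. The
    trapezoidal sum of the discrete flux vanishes, by the boundary values of the
    discrete u, and so does the integral of p; hence e is the opposite of the
    integral of d. *)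
Lemma flux_error x : 0 <= x <= 1 -> `|p x - pT x| <= 2 * hmax M * B.
Proof.
move=> x01; have [e eE] := flux_nodal_error.
pose d x := p x - expansion id M (fun j => p (vtx M j)) x.
have pTE y : 0 <= y <= 1 -> p y - pT y = d y + e.
  move=> /(vtx_cover M)[k kn ky]; rewrite /d.
  rewrite !(expansion_cell _ compatible_id kn ky).
  have := eE k (ltnW kn); have := eE k.+1 kn.
  move=> e1 e2; rewrite -[X in _ - X](subrK (p (vtx M k))).
  have -> : ph k = p (vtx M k) - e by rewrite -e2; ring.
  have -> : ph k.+1 = p (vtx M k.+1) - e by rewrite -e1; ring.
  by ring.
have d1 : L1on 0 1 d by apply: L2on_L1; apply: L2onB p2 (expansion_id_L2 _).
have eI : e = - itvint 0 1 d.
  rewrite /d itvintB; [|exact: L2on_L1|exact/L2on_L1/expansion_id_L2].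
  have -> : itvint 0 1 p = 0.
    by case: up => _ /(_ 0 1) <- //; rewrite u0 u1 subrr.
  rewrite sub0r opprK (itvint_mesh M); last exact/L2on_L1/expansion_id_L2.
  rewrite (eq_bigr (fun k : 'I__ => 2^-1 * hcell M k * (p (vtx M k) + p (vtx M
    k.+1)))).
    rewrite (hdual_sum M (fun j => p (vtx M j))).
    case: fvs => uh0 uhn phE _.
    have : \sum_(j < (ncell M).+1) hdual M j * ph j = 0.
      rewrite (eq_bigr (fun j : 'I__ => uh j.+1 - uh j)); last first.
        by move=> [j jn] _ /=; rewrite phE.
      by rewrite -(big_mkord xpredT (fun j => uh j.+1 - uh j)) telescope_sumr//
        uh0 uhn subrr.
    move=> s0; rewrite -[RHS]subr0 -[X in _ = _ - X]s0 -sumrB.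
    rewrite (eq_bigr (fun j : 'I__ => hdual M j * e)).
      by rewrite -mulr_suml sum_hdual mul1r.
    by move=> [j jn] _ /=; rewrite -(eE j)// mulrBr.
  by move=> [k kn] _ /=; rewrite itvint_cell_affine.
have eb : `|e| <= hmax M * B.
  rewrite eI normrN (le_trans (normr_itvint_le (K :=
    hmax M * B) ler01 d1 _)) ?subr0 ?mulr1//.
  by move=> t /andP[t0 t1]; rewrite interpolation_error// !ltW.
rewrite pTE// (le_trans (ler_normD _ _))//.
have := interpolation_error x01; rewrite -/(d x); lra.
Qed.

(** The discrete u is a trapezoidal sum of the discrete flux, and the
    trapezoidal rule is exact on affine functions; only the half cell after
    the vertex k remains. *)
Lemma value_trapezoid k : (k < ncell M)%N ->
  uh k.+1 = itvint 0 (vtx M k) pT + 2^-1 * hcell M k * ph k.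
Proof.
case: fvs => uh0 _ phE _.
elim: k => [n0|k IH kn].
  rewrite vtx0 itvintxx add0r; have := phE 0%N isT; rewrite uh0 subr0 => <-.
  by rewrite /hdual.
have kn' := ltnW kn; have [h0 hlt h1] := vtx_itv kn'.
have -> : uh k.+2 = uh k.+1 + hdual M k.+1 * ph k.+1.
  by rewrite phE// addrC subrK.
rewrite IH// (itvint_cat h0 (ltW hlt)); last first.
  by apply: L1on_sub (L2on_L1 (expansion_id_L2 ph)).
rewrite [X in _ = _ + X + _]itvint_cell_affine// /hdual /= (ltn_eqF kn); ring.
Qed.

Lemma value_error k x : (k < ncell M)%N -> vtx M k < x < vtx M k.+1 ->
  `|u x - uh k.+1| <= hmax M * (3 * B + 3 / 2 * A).
Proof.
move=> kn /andP[kx xk]; have [h0 hlt h1] := vtx_itv kn; have hk := hcell_gt0 kn.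
have hm := hcell_le_hmax kn; have x1 := le_trans (ltW xk) h1.
have p1 := L2on_L1 p2; have pT1 : L1on 0 1 pT := L2on_L1 (expansion_id_L2 ph).
have k1 : vtx M k <= 1 by rewrite (le_trans (ltW hlt)).
have ux : u x = itvint 0 (vtx M k) p + itvint (vtx M k) x p.
  rewrite -(itvint_cat h0 (ltW kx)); last exact: L1on_sub p1.
  by case: up => _ <- //; [rewrite u0 subr0|rewrite (le_trans h0)// ltW].
have p1k : L1on 0 (vtx M k) p by exact: L1on_sub p1.
have pT1k : L1on 0 (vtx M k) pT by exact: L1on_sub pT1.
rewrite value_trapezoid// ux.
have e1 : `|itvint 0 (vtx M k) (fun t => p t - pT t)| <= 2 * hmax M * B.
  rewrite (le_trans (normr_itvint_le (K := 2 * hmax M * B) h0 _ _))//.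
  - exact: L1onB.
  - by move=> t /andP[t0 tk]; rewrite flux_error// ltW//= (le_trans (ltW tk)).
  by rewrite subr0 ler_piMr// !mulr_ge0 ?hmax_ge0 ?sqrtr_ge0.
rewrite itvintB// in e1.
have e2 : `|itvint (vtx M k) x p| <= A * hcell M k.
  rewrite (le_trans (normr_itvint_le (K := A) (ltW kx) _ _))//.
  - by apply: L1on_sub p1 => //; exact: ltW.
  - move=> t /andP[kt tx]; rewrite flux_bound// (le_trans h0 (ltW kt)).
    by rewrite (le_trans (ltW tx)).
  by rewrite ler_wpM2l ?sqrtr_ge0// /hcell lerD2r ltW.
have e3 : `|ph k| <= A + 2 * hmax M * B.
  have k01 : 0 <= vtx M k <= 1 by rewrite h0.
  have := flux_error k01; rewrite expansion_vtx ?(ltnW kn)//;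
    last exact: compatible_id.
  have := flux_bound k01; move=> a1 a2.
  rewrite -[ph k](subrK (p (vtx M k))) (le_trans (ler_normD _ _))// addrC
    lerD//.
  by rewrite distrC.
have hk1 : hcell M k <= 1 by rewrite /hcell lerBlDr (le_trans h1)// lerDl.
have A0 : 0 <= A := sqrtr_ge0 _; have B0 : 0 <= B := sqrtr_ge0 _.
have hm0 := hmax_ge0 M.
have e4 : `|2^-1 * hcell M k * ph k| <= hmax M * (2^-1 * A) + hmax M * B.
  rewrite normrM ger0_norm ?mulr_ge0 ?(ltW hk) ?invr_ge0//.
  rewrite (le_trans (ler_wpM2l _ e3)) ?mulr_ge0 ?(ltW hk) ?invr_ge0//.
  rewrite mulrDr lerD//.
    by rewrite -mulrA mulrCA ler_wpM2r// mulr_ge0 ?invr_ge0.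
  rewrite (_ : 2^-1 * hcell M k * (2 * hmax M * B) = hcell M k * (hmax M * B));
    last by field.
  by rewrite ler_piMl// mulr_ge0.
have e5 : A * hcell M k <= hmax M * A by rewrite mulrC ler_wpM2r.
move: e1 e2 e4; rewrite !ler_norml => /andP[? ?] /andP[? ?] /andP[? ?].
by apply/andP; split; lra.
Qed.

(** Cauchy-Schwarz for the variation of f over the cell gains the length of the
    cell; integrating over the cell gains it once more. *)
Lemma average_error k x : (k < ncell M)%N -> vtx M k < x < vtx M k.+1 ->
  (f x - avg k) ^+ 2 <= hcell M k * itvint (vtx M k) (vtx M k.+1) (fun t => g t
    ^+ 2).
Proof.
move=> kn /andP[kx xk]; have [h0 hlt h1] := vtx_itv kn.
have o : `|f x - avg k| <= G k by apply: cell_oscillation; rewrite // !ltW.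
have gk : L2on (vtx M k) (vtx M k.+1) (fun t => `|g t|).
  have [mg gg] : L2on (vtx M k) (vtx M k.+1) g by apply: L2on_sub g2.
  split; first exact: measurableT_comp.
  by apply: eq_L1on gg => t _; rewrite real_normK// num_real.
have := itvint_sqr_le (ltW hlt) gk;
  rewrite -/(cellint M (fun t => `|g t|) k) -/(hcell M k).
rewrite (@eq_itvint _ _ _ (fun t => `|g t| ^+ 2) (fun t => g t ^+ 2));
  last first.
  by move=> t _; rewrite real_normK// num_real.
apply: le_trans; rewrite -real_normK ?num_real// ler_sqr ?nnegrE//.
exact: cell_variation_ge0.
Qed.

Lemma average_errorL2 (F : R -> R) : L1on 0 1 F ->
  (forall k x, (k < ncell M)%N -> vtx M k < x < vtx M k.+1 ->
    F x = (f x - avg k) ^+ 2) ->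
  itvint 0 1 F <= hmax M ^+ 2 * itvint 0 1 (fun t => g t ^+ 2).
Proof.
move=> F1 FE; have [_ gg] := g2.
rewrite (itvint_mesh M F1) (itvint_mesh M gg) mulr_sumr.
apply: ler_sum => -[k kn] _ /=; have [h0 hlt h1] := vtx_itv kn;
  have hk := hcell_gt0 kn.
set Ik := itvint _ _ (fun t => g t ^+ 2).
have Ik0 : 0 <= Ik by apply: itvint_ge0 => x _; exact: sqr_ge0.
apply: (@le_trans _ _ (hcell M k * Ik * hcell M k)).
  rewrite -(@itvint_cst _ _ _ (hcell M k * Ik) (ltW hlt)).
  apply: le_itvint; [exact: L1on_sub F1|exact: L1on_cst|].
  by move=> x xk; rewrite (FE k)//; exact: average_error.
rewrite mulrAC -expr2 ler_wpM2r// ler_sqr ?nnegrE ?hmax_ge0 ?(ltW hk)//.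
exact: hcell_le_hmax.
Qed.

End Core.
End ErrorEstimate.

(** * Error estimate in the norms of L^2 and H^1 *)

Section MainEstimate.
Context {R : realType}.
Implicit Types (a b x : R) (f g p q u uT pT : R -> R) (M : mesh R).
Local Notation mu := (@lebesgue_measure R).

Lemma eq_ae_primitive q g g' : {ae mu, forall x, 0 < x < 1 -> g x = g' x} ->
  L2on 0 1 g' -> primitive 0 1 q g -> primitive 0 1 q g'.
Proof.
move=> gg' g2' [g2 qg]; split => // x y x0 xy y1; rewrite qg//.
by apply: eq_ae_itvint => //; [apply: L1on_sub (L2on_L1 g2)|apply: L1on_sub
  (L2on_L1 g2')].
Qed.

Lemma eq_ae_itvint_sqr f g : L2on 0 1 f -> L2on 0 1 g ->
  {ae mu, forall x, 0 < x < 1 -> f x = g x} ->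
  itvint 0 1 (fun x => f x ^+ 2) = itvint 0 1 (fun x => g x ^+ 2).
Proof.
move=> [_ f2] [_ g2] fg; apply: eq_ae_itvint => //.
by apply: ae_weaken fg => x fgx x01; rewrite fgx.
Qed.

Lemma norm01_le f K : 0 <= K -> itvint 0 1 (fun x => f x ^+ 2) <= K ^+ 2 ->
  norm01 f <= K.
Proof. by move=> K0 fK; rewrite -[leRHS]ger0_norm// -sqrtr_sqr ler_wsqrtr. Qed.

Lemma normL2_norm01 f : L2on 0 1 f -> normL2 f = (norm01 f)%:E.
Proof. by move=> [_ f2]; rewrite normL2E. Qed.

Lemma normH1E q : H1 q ->
  normH1 q = (Num.sqrt (norm01 q ^+ 2 + norm01 (wderiv q) ^+ 2))%:E.
Proof.
move=> qH1; rewrite /normH1 asboolT//; have [w2 _] := wderivP qH1.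
have q2 : L2on 0 1 q by case: qH1 => /L2P.
by rewrite !normL2_norm01// -!EFin_expe.
Qed.

(** The square root is at most sqrt 5 h B <= 3 h B, and A and B are at most
    sqrt (A^2 + B^2), which gives 3 + 3/2 + 3 <= 8. *)
Lemma error_constant (h A B X Y Z : R) : 0 <= h -> 0 <= A -> 0 <= B ->
  0 <= Y -> 0 <= Z ->
  X <= h * (3 * B + 3 / 2 * A) -> Y <= 2 * h * B -> Z <= h * B ->
  X + Num.sqrt (Y ^+ 2 + Z ^+ 2) <= 8 * h * Num.sqrt (A ^+ 2 + B ^+ 2).
Proof.
move=> h0 A0 B0 Y0 Z0 XE YE ZE; set N := Num.sqrt (A ^+ 2 + B ^+ 2).
have AN : A <= N.
  by rewrite -[leLHS]ger0_norm// -sqrtr_sqr ler_wsqrtr// lerDl sqr_ge0.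
have BN : B <= N.
  by rewrite -[leLHS]ger0_norm// -sqrtr_sqr ler_wsqrtr// lerDr sqr_ge0.
have H : Num.sqrt (Y ^+ 2 + Z ^+ 2) <= 3 * (h * B).
  rewrite -[leRHS]ger0_norm ?mulr_ge0// -sqrtr_sqr ler_wsqrtr//.
  have e1 : Y ^+ 2 <= (2 * h * B) ^+ 2 by rewrite ler_sqr ?nnegrE// !mulr_ge0.
  have e2 : Z ^+ 2 <= (h * B) ^+ 2 by rewrite ler_sqr ?nnegrE// mulr_ge0.
  by rewrite (le_trans (lerD e1 e2))//; have := sqr_ge0 (h * B); lra.
have hA : h * A <= h * N by rewrite ler_wpM2l.
have hB : h * B <= h * N by rewrite ler_wpM2l.
have hN : 0 <= h * N by rewrite mulr_ge0// sqrtr_ge0.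
lra.
Qed.

(** f and p = u' are only given up to null sets. Their continuous
    representatives solve the same problem and have the same discretization, and
    the L^2 norms of the errors are the same; the derivative of p - p_T is
    identified almost everywhere by uniqueness of weak derivatives. *)
Lemma fv_error_estimate M f u uT pT : H1 f -> poisson_solution f u ->
  fv_solution M f uT pT ->
  (normL2 (u \- uT)%R + normH1 (wderiv u \- pT)%R <=
   (8 * hmax M)%:E * normH1 f)%E.
Proof.
move=> fH1 [uH1 uc u0 u1 pweak] [uh [ph [fv uTE pTE]]].
have [g2 gweak] := wderivP fH1; set g := wderiv f in g2 gweak.
have f2 : L2on 0 1 f by case: fH1 => /L2P.
have up := wderiv_primitive uc uH1; set p := wderiv u in up pweak *.
have p2 : L2on 0 1 p by case: up.
have nf2 : L2on 0 1 (\- f) := L2onN f2.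
have [k1 fae] := weak_deriv_ae_rep f2 g2 gweak.
have [k2 pae] := weak_deriv_ae_rep p2 nf2 pweak.
(* The continuous representatives of f and of p. *)
pose ft x := k1 + itvint 0 x g; pose pt x := k2 + itvint 0 x (\- f).
have ftg : primitive 0 1 ft g.
  have := primitiveD (primitive_cst 0 1 k1) (primitive_itvint g2).
  by apply: eq_primitive => // x _; rewrite add0r.
have ft2 : L2on 0 1 ft := L2on_continuous (primitive_continuous ler01 ftg).
have ptf : primitive 0 1 pt (fun x => - ft x).
  apply: (@eq_ae_primitive _ (\- f)).
  - by apply: ae_weaken fae => x fx x01 /=; rewrite fx.
  - exact: L2onN.
  have := primitiveD (primitive_cst 0 1 k2) (primitive_itvint nf2).
  by apply: eq_primitive => // x _; rewrite add0r.
have pt2 : L2on 0 1 pt := L2on_continuous (primitive_continuous ler01 ptf).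
have upt : primitive 0 1 u pt by exact: eq_ae_primitive up.
have fvt : fv_scheme M ft uh ph.
  case/(fv_schemeP _ _ _ f2): fv => a1 a2 a3 a4; apply/fv_schemeP => //.
  split=> // j jn; rewrite a4// /cellint; have [h0 hlt h1] := vtx_itv jn.
  congr (- _); apply: eq_ae_itvint => //.
  - by apply: L1on_sub (L2on_L1 f2).
  - by apply: L1on_sub (L2on_L1 ft2).
have normf : norm01 ft = norm01 f.
  by rewrite /norm01 (eq_ae_itvint_sqr f2 ft2 fae).
have pTE' x : 0 <= x <= 1 -> pT x = expansion id M ph x.
  by move=> x01; rewrite pTE// in_itv.
have pTprim : primitive 0 1 pT (expansion_deriv (fun=> 1) M ph).
  have := expansion_primitive M ph compatible_id (primitive_id 0 1).
  by apply: eq_primitive => // x /pTE'.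
have pT2 := L2on_continuous (primitive_continuous ler01 pTprim).
have [S2 _] := pTprim; set S := expansion_deriv _ M ph in pTprim S2.
set B := norm01 g; set A := norm01 f; set h := hmax M.
have A0 : 0 <= A := sqrtr_ge0 _; have B0 : 0 <= B := sqrtr_ge0 _.
have h0 : 0 <= h := hmax_ge0 M.
have uuT2 : L2on 0 1 (u \- uT).
  apply: (@L2on_mesh _ M) => k kn; have [x0 hlt x1] := vtx_itv kn.
  apply: (@eq_L2on _ _ _ (fun x => u x - uh k.+1)).
    by move=> x kx; rewrite /= (uTE k)// in_itv.
  apply: L2onB; last exact: L2on_cst.
  by apply: L2on_sub (L2on_continuous uc).
have errU : norm01 (u \- uT) <= h * (3 * B + 3 / 2 * A).
  have K0 : 0 <= h * (3 * B + 3 / 2 * A)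
    by rewrite mulr_ge0// addr_ge0// mulr_ge0.
  apply: norm01_le => //; apply: (@itvint_le_cells _ M); first by case: uuT2.
  move=> k x kn kx; rewrite /= (uTE k) ?in_itv//.
  rewrite -real_normK ?num_real// ler_sqr ?nnegrE//.
  by have := value_error ftg ptf upt u0 u1 fvt kn kx; rewrite normf.
have ppT2 : L2on 0 1 (p \- pT) by exact: L2onB.
have errP : norm01 (p \- pT) <= 2 * h * B.
  have K0 : 0 <= 2 * h * B by rewrite !mulr_ge0.
  apply: norm01_le => //.
  rewrite (@eq_ae_itvint_sqr _ (pt \- pT)) //; last 2 first.
  - exact: L2onB.
  - by apply: ae_weaken pae => x px x01; rewrite /= px.
  apply: (@itvint_le_cells _ M); first by have [] := L2onB pt2 pT2.
  move=> k x kn kx /=; have x01 := cell_sub kn kx; rewrite pTE'//.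
  rewrite -real_normK ?num_real// ler_sqr ?nnegrE//.
  exact: (flux_error ftg ptf upt u0 u1 fvt x01).
have weakP : is_weak_deriv (p \- pT) ((\- f) \- S).
  exact: weak_derivB p2 nf2 pT2 S2 pweak (primitive_weak_deriv pTprim).
have ppTH1 : H1 (p \- pT).
  split; first exact/L2P.
  by exists ((\- f) \- S); split => //; apply/L2P; exact: L2onB.
have [W2 Wweak] := wderivP ppTH1.
have errD : norm01 (wderiv (p \- pT)) <= h * B.
  have K0 : 0 <= h * B by rewrite mulr_ge0.
  apply: norm01_le => //.
  have E2 : L2on 0 1 (fun x => - ft x - S x) by apply: L2onB => //;
    exact: L2onN.
  rewrite (@eq_ae_itvint_sqr _ (fun x => - ft x - S x)) //; last first.
    have nfS : L2on 0 1 ((\- f) \- S) by exact: L2onB.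
    have := ae_and (weak_deriv_ae_unique W2 nfS Wweak weakP) fae.
    by apply: ae_weaken => x [Wx fx] x01; rewrite Wx//= fx.
  rewrite exprMn /B [norm01 g ^+ 2]sqr_sqrtr; last by apply: itvint_ge0 => x _;
    exact: sqr_ge0.
  apply: (average_errorL2 ftg (M := M)); first by case: E2.
  move=> k x kn kx; rewrite /S /expansion_deriv (cellwiseE _ kn kx).
  case/(fv_schemeP _ _ _ ft2): fvt => _ _ _ ->//; rewrite /cellavg; ring.
rewrite (normH1E ppTH1) (normH1E fH1) (normL2_norm01 uuT2) -/g -/A -/B.
rewrite -EFinD -EFinM lee_fin.
exact: (error_constant h0 A0 B0 (sqrtr_ge0 _) (sqrtr_ge0 _) errU errP errD).
Qed.

End MainEstimate.

Theorem theorem4 (R : realType) (alpha beta : R) :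
  0 < alpha -> alpha < 1 -> 1 < beta ->
  exists C : R, 0 < C /\
  forall psi : R -> R, admissible_shape psi ->
    (* (i) *)
    (forall (f : R -> R) (M : mesh R), L2 f -> uniformly_regular alpha beta M ->
      [/\ exists uh ph : nat -> R, fv_scheme M f uh ph,
          forall uh ph uh' ph' : nat -> R,
            fv_scheme M f uh ph -> fv_scheme M f uh' ph' ->
            (forall j, (j <= (ncell M).+1)%N -> uh j = uh' j) /\
            (forall j, (j <= ncell M)%N -> ph j = ph' j) &
          forall uT pT : R -> R,
            fv_solution M f uT pT <-> pg_solution psi M f uT pT])
    /\
    (* (ii) *)
    (forall (f u : R -> R) (M : mesh R) (uT pT : R -> R),
      H1 f -> poisson_solution f u -> uniformly_regular alpha beta M ->
      fv_solution M f uT pT ->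
      (normL2 (u \- uT)%R + normH1 (wderiv u \- pT)%R
        <= (C * hmax M)%:E * normH1 f)%E).
Proof.
move=> _ _ _; exists 8; split=> // psi adm.
split=> [f M /L2P f2 _|f u M uT pT fH1 fu _]; last exact: fv_error_estimate.
split.
- by exists (fv_value M f), (fv_flux M f); exact: fv_exists.
- move=> uh ph uh' ph' /(fv_explicit f2)[uE pE] /(fv_explicit f2)[uE' pE'].
  by split=> j jn; [rewrite uE ?uE'|rewrite pE ?pE'].
- move=> uT pT; split; [exact: fv_pg|exact: pg_fv].
Qed.
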